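(* Let $w\in\mathcal S(\mathbb R;\mathbb R)$, set $q=w'-w^2$ and $I(w)=\int_{\mathbb R}w(x)\,dx$. Then $H_q\ge0$, the potential $q$ is exceptional at zero energy, and \[ f_+(x,0)=\exp\left(\int_x^\infty w(t)\,dt\right),\qquad f_-(x,0)=\exp\left(-\int_{-\infty}^xw(t)\,dt\right). \] Consequently \[ a_q(0)=\cosh I(w),\qquad b_q(0)=-\sinh I(w),\qquad T_q(0)=\operatorname{sech}I(w),\qquad R_q(0)=-\tanh I(w). \]
   Context: $\mathcal S(\mathbb R;\mathbb R)$ is the space of real-valued Schwartz functions on $\mathbb R$. For $q\in\mathcal S(\mathbb R;\mathbb R)$, $H_q=-\partial_x^2-q$ is the Schr\''odinger operator (note the sign of $q$), self-adjoint on $L^2(\mathbb R)$. For $\operatorname{Im}k\ge 0$ the Jost solutions $f_\pm(\cdot,k)$ are the solutions of $-y''-qy=k^2y$ fixed by $f_+(x,k)=e^{ikx}(1+o(1))$ as $x\to+\infty$ and $f_-(x,k)=e^{-ikx}(1+o(1))$ as $x\to-\infty$ (at $k=0$, $f_\pm(x,0)\to 1$ as $x\to\pm\infty$). The potential $q$ is exceptional at zero energy if the Wronskian $W(f_-(\cdot,0),f_+(\cdot,0))$ vanishes, where $W(f,g)=fg'-f'g$; equivalently, $f_-(\cdot,0)$ and $f_+(\cdot,0)$ are linearly dependent. For real $k\ne 0$ the coefficients $a_q(k),b_q(k)$ are defined by $f_-(x,k)=a_q(k)f_+(x,-k)+b_q(k)f_+(x,k)$, and $T_q(k)=1/a_q(k)$,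 $R_q(k)=b_q(k)/a_q(k)$. Values at $k=0$ are understood as limits as $k\to 0$ along the real axis. *)

(* Defs.v *)
From HB Require Import structures.
From mathcomp Require Import all_boot all_order all_algebra.
From mathcomp Require Import all_classical all_reals all_analysis.
From mathcomp Require Import complex.

Set Implicit Arguments.
Unset Strict Implicit.
Unset Printing Implicit Defensive.

Import Order.TTheory GRing.Theory Num.Theory.
Import numFieldNormedType.Exports.

Local Open Scope classical_set_scope.
Local Open Scope ring_scope.
Local Open Scope complex_scope.

Section Hyperbolic.
Context {R : realType}.
Implicit Type x : R.

Definition cosh x : R := (expR x + expR (- x)) / 2.
Definition sinh x : R := (expR x - expR (- x)) / 2.
Definition sech x : R := (cosh x)^-1.
Definition tanh x : R := sinh x / cosh x.

End Hyperbolic.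

Definition schwartz (R : realType) (w : R -> R) : Prop :=
  (forall (n : nat) (x : R), derivable (w^`(n))%classic x 1) /\
  (forall m n : nat, exists M : R, forall x : R, `|x ^+ m * (w^`(n))%classic x| <= M).

(* [R[i]] is not a normed space over [R] in the library, so differentiation and
   integration of functions [R -> R[i]] are taken on real and imaginary parts.
   Limits use the topology of [R[i]^o] given by the complex modulus. *)
Section ComplexValued.
Context {R : realType}.
Implicit Types (f g : R -> R[i]) (x : R).

Notation mu := (@lebesgue_measure R).

Definition reP f : R -> R := fun x => complex.Re (f x).
Definition imP f : R -> R := fun x => complex.Im (f x).

Definition cexp (z : R[i]) : R[i] :=
  (expR (complex.Re z))%:C * (cos (complex.Im z) +i* sin (complex.Im z)).

Definition cderivable f x : Prop :=
  derivable (reP f) x 1 /\ derivable (imP f) x 1.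

Definition cderive f : R -> R[i] :=
  fun x => ((reP f)^`())%classic x +i* ((imP f)^`())%classic x.

Definition cintegrable (A : set R) f : Prop :=
  mu.-integrable A (EFin \o reP f) /\ mu.-integrable A (EFin \o imP f).

Definition cintegral (A : set R) f : R[i] :=
  (\int[mu]_(x in A) reP f x) +i* (\int[mu]_(x in A) imP f x).

Definition L2 f : Prop :=
  reP f \in Lfun mu 2%:E /\ imP f \in Lfun mu 2%:E.

Definition inner f g : R[i] := cintegral setT (fun x => conjc (f x) * g x).

(* [f] is locally absolutely continuous and [f' = g] almost everywhere *)
Definition ac_derivative f g : Prop :=
  forall x y : R, x <= y ->
    cintegrable `[x, y] g /\ f y - f x = cintegral `[x, y] g.

(* Graph of [H_q = - d^2/dx^2 - q] on [L^2(R)] with domain the Sobolev space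
   [H^2(R)]: an element of the domain is represented by its [C^1]
   representative [psi], with [psi'] locally absolutely continuous and
   [psi, psi', psi''] square integrable. *)
Definition schrodinger (q : R -> R) (psi phi : R -> R[i]) : Prop :=
  exists psi1 psi2 : R -> R[i],
    [/\ L2 psi, L2 psi1 & L2 psi2] /\
    [/\ ac_derivative psi psi1, ac_derivative psi1 psi2 &
        forall x, phi x = - psi2 x - (q x)%:C * psi x].

(* [0 <= z] in [R[i]] means that [z] is real and nonnegative. *)
Definition schrodinger_ge0 (q : R -> R) : Prop :=
  forall psi phi, schrodinger q psi phi -> 0 <= inner psi phi.

Definition energy_solution (q : R -> R) (k : R[i]) (y : R -> R[i]) : Prop :=
  forall x : R, [/\ cderivable y x, cderivable (cderive y) x &
    - cderive (cderive y) x - (q x)%:C * y x = k ^+ 2 * y x].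

Definition is_jost_plus (q : R -> R) (k : R[i]) (y : R -> R[i]) : Prop :=
  energy_solution q k y /\
  (y x / cexp ('i%C * k * x%:C) : R[i]^o) @[x --> +oo] --> (1 : R[i]^o).

Definition is_jost_minus (q : R -> R) (k : R[i]) (y : R -> R[i]) : Prop :=
  energy_solution q k y /\
  (y x / cexp (- ('i%C * k * x%:C)) : R[i]^o) @[x --> -oo] --> (1 : R[i]^o).

(* [f_+(x,k)] and [f_-(x,k)] are [jost_plus q k x] and [jost_minus q k x], the
   solutions determined by their asymptotics when [Im k >= 0]; the default
   value [0] is not itself a Jost solution. *)
Definition jost_plus (q : R -> R) (k : R[i]) : R -> R[i] :=
  xget (fun=> 0) [set y | is_jost_plus q k y].

Definition jost_minus (q : R -> R) (k : R[i]) : R -> R[i] :=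
  xget (fun=> 0) [set y | is_jost_minus q k y].

Definition wronskian f g : R -> R[i] :=
  fun x => f x * cderive g x - cderive f x * g x.

Definition exceptional (q : R -> R) : Prop :=
  forall x, wronskian (jost_minus q 0) (jost_plus q 0) x = 0.

(* The pair [(a_q(k), b_q(k))], which exists and is unique for real [k != 0]. *)
Definition scattering_coeffs (q : R -> R) (k : R) : R[i] * R[i] :=
  xget (0, 0) [set ab : R[i] * R[i] | forall x : R,
    jost_minus q k%:C x =
      ab.1 * jost_plus q (- k%:C) x + ab.2 * jost_plus q k%:C x].

Definition scat_a (q : R -> R) (k : R) : R[i] := (scattering_coeffs q k).1.
Definition scat_b (q : R -> R) (k : R) : R[i] := (scattering_coeffs q k).2.
Definition scat_T (q : R -> R) (k : R) : R[i] := 1 / scat_a q k.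
Definition scat_R (q : R -> R) (k : R) : R[i] := scat_b q k / scat_a q k.

(* [g(0) = l], with [g(0)] understood as the limit along the real axis *)
Definition value_at_zero (g : R -> R[i]) (l : R[i]) : Prop :=
  (g k : R[i]^o) @[k --> 0^'] --> (l : R[i]^o).

End ComplexValued.

(* Main.v *)
Require Import Defs.
From HB Require Import structures.
From mathcomp Require Import all_boot all_order all_algebra.
From mathcomp Require Import all_classical all_reals all_analysis.
From mathcomp Require Import measurable_realfun complex ring lra.

Import Order.TTheory GRing.Theory Num.Theory.
Import numFieldNormedType.Exports.

Local Open Scope classical_set_scope.
Local Open Scope ring_scope.
Local Open Scope complex_scope.

(** With [q = w' - w ^ 2] the operator factors as [H_q = (d + w)^* (d + w)],
    where [d = d/dx]; every claim is read off this Miura factorization.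

    Integrating by parts gives [<psi, H_q psi> = | (d + w) psi | ^ 2 >= 0]
    ([miura_form], [miura_schrodinger_ge0]).  Elements of the domain have only an
    absolutely continuous derivative, so the product rule is obtained from
    Fubini on a triangle ([real_acM]); the boundary term is an integrable
    function with limits at both ends, which must then be zero.

    At zero energy [(d + w) f = 0] is solved by [exp (- \int w)], which has
    nonzero limits at both ends.  Normalizing it at [+oo] and at [-oo] gives the
    two Jost solutions, which are therefore proportional.

    At energy [k ^ 2] with [k] real and nonzero, put [k v = y' + w y].  Then
    [y' = - w y + k v] and [v' = w v - k y], and the components [al], [be] of
    [exp (ikx) (y + iv)] satisfy a first order system whose coefficients are
    dominated by the integrable function [|w|] ([zs_solution]).  Such a system
    is solvable with data prescribed at [-oo] ([linear_system_solution]), and its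
    solutions have limits at [+oo].  If the data [(1, 0)] and [(0, 1)] are
    transferred to [(A, C)] and [(B, D)], then [A D - B C = 1], both Jost
    solutions are explicit combinations of the two waves, and

      [a = (A + D)/2 + i (C - B)/2],  [b = (A - D)/2 - i (B + C)/2]

    ([transfer_scattering]).  As [k -> 0] the system becomes diagonal, and the
    transfer matrix differs from [diag (exp (- I), exp I)] by at most a multiple
    of [k] times the integral of [|x w|] ([zs_connection]); this gives [cosh I]
    and [- sinh I].

    A Jost solution is defined by its asymptotics, so these identifications need
    uniqueness: a solution vanishing at one end vanishes identically
    ([vanishing_solution]), because its derivative tends to zero as well and all
    its Wronskians with bounded solutions are zero. *)

(** * Derivatives and primitives on the line *)

Section Derivatives.
Context {R : realType}.
Implicit Types (f g F G : R -> R) (a b l m x y : R).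

Lemma is_derive_fun_add {f g x a b} : is_derive x 1 f a -> is_derive x 1 g b ->
  is_derive x 1 (fun t => f t + g t) (a + b).
Proof. by move=> fa gb; exact: is_deriveD. Qed.

Lemma is_derive_fun_sub {f g x a b} : is_derive x 1 f a -> is_derive x 1 g b ->
  is_derive x 1 (fun t => f t - g t) (a - b).
Proof. by move=> fa gb; exact: is_deriveB. Qed.

Lemma is_derive_fun_opp {f x a} : is_derive x 1 f a ->
  is_derive x 1 (fun t => - f t) (- a).
Proof. by move=> fa; exact: is_deriveN. Qed.

Lemma is_derive_fun_mul {f g x a b} : is_derive x 1 f a -> is_derive x 1 g b ->
  is_derive x 1 (fun t => f t * g t) (a * g x + f x * b).
Proof.
move=> fa gb; have := is_deriveM fa gb.
by rewrite /GRing.scale /= addrC [g x * a]mulrC.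
Qed.

Lemma is_derive_fun_scale {f x a} c : is_derive x 1 f a ->
  is_derive x 1 (fun t => c * f t) (c * a).
Proof.
move=> fa; have := is_derive_fun_mul (is_derive_cst c x 1) fa.
by rewrite mul0r add0r.
Qed.

Lemma is_derive_fun_expR {f x a} : is_derive x 1 f a ->
  is_derive x 1 (fun t => expR (f t)) (expR (f x) * a).
Proof. by move=> fa; exact: (is_derive1_comp (f := expR)). Qed.

Lemma is_derive_continuous {f} {df : R -> R} :
  (forall x, is_derive x 1 f (df x)) -> continuous f.
Proof.
by move=> fE x; apply/differentiable_continuous/derivable1_diffP; case: (fE x).
Qed.

Lemma is_derive_ger0_le {F} {df : R -> R} :
  (forall x, is_derive x 1 F (df x)) -> (forall x, 0 <= df x) ->
  forall x y, x <= y -> F x <= F y.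
Proof.
move=> FE df0 x y xy.
have [c _ e] := MVT_segment xy (fun z _ => FE z)
  (continuous_subspaceT (is_derive_continuous FE)).
by rewrite -subr_ge0 e mulr_ge0// subr_ge0.
Qed.

(** Comparing derivatives bounds increments; letting the left endpoint go to
    [-oo] makes this a bound on the distance to the limit.  The Picard iteration
    and the small momentum estimate both rest on it. *)
Lemma le_derive_cvgNy {F G : R -> R} {f g : R -> R} {l m} :
  (forall x, is_derive x 1 F (f x)) -> (forall x, is_derive x 1 G (g x)) ->
  (forall x, `|f x| <= g x) ->
  F x @[x --> -oo] --> l -> G x @[x --> -oo] --> m ->
  forall x, `|F x - l| <= G x - m.
Proof.
move=> FE GE fg Fl Gm x.
have inc (s : R) : s \in [:: 1; -1] -> s * F x - s * l <= G x - m.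
  move=> s1.
  suff : G x - s * F x >= m - s * l by lra.
  apply: (@cvgr_to_le _ -oo _ _ (fun t => G t - s * F t)).
    by apply: cvgB => //; exact: cvgMl_tmp.
  near=> t.
  have D (z : R) : is_derive z 1 (fun t : R => G t - s * F t) (g z - s * f z).
    by apply: is_derive_fun_sub => //; exact: is_derive_fun_scale.
  apply: (is_derive_ger0_le D).
    move=> z; move: (fg z); rewrite ler_norml => /andP[h1 h2].
    by move: s1; rewrite !inE => /orP[]/eqP ->; lra.
  by near: t; apply: nbhs_ninfty_le; exact: num_real.
have := inc 1; have := inc (-1); rewrite !inE !eqxx orbT => /(_ isT) h1 /(_ isT) h2.
by rewrite ler_norml; apply/andP; split; lra.
Unshelve. all: by end_near. Qed.

End Derivatives.

Section Primitive.
Context {R : realType}.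
Notation mu := (@lebesgue_measure R).
Implicit Types (f g F G : R -> R) (a b l m x y : R).

Lemma continuous_le_integrable f g : continuous f ->
  mu.-integrable setT (EFin \o g) -> (forall x, `|f x| <= g x) ->
  mu.-integrable setT (EFin \o f).
Proof.
move=> cf ig fg; apply: le_integrable ig => //.
  by apply/measurable_EFinP; exact: continuous_measurable_fun.
by move=> x _ /=; rewrite lee_fin (le_trans (fg x))// ler_norm.
Qed.

Definition primitive f x : R := \int[mu]_(t in `]-oo, x]) f t.

Lemma is_derive_primitive f x : continuous f ->
  mu.-integrable setT (EFin \o f) -> is_derive x 1 (primitive f) (f x).
Proof.
move=> cf if_.
have [] := @continuous_FTC1 R f -oo%O x (x + 1).
- by rewrite ltrDl.
- by apply: integrableS if_.
- exact: ltNyr.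
- exact: cf.
rewrite derive1E => d e; split; [exact: d|exact: e].
Qed.

(** Dominated convergence along a sequence; both limits of the primitive are
    instances, the whole line and the empty set being the limit domains. *)
Lemma primitive_cvg_seq f (u : R^nat) (A : set R) : measurable A ->
  mu.-integrable setT (EFin \o f) ->
  (forall t, \forall n \near \oo, (t \in `]-oo, u n]%classic) = (t \in A)) ->
  primitive f (u n) @[n --> \oo] --> \int[mu]_(t in A) f t.
Proof.
move=> mA if_ uA; apply: fine_cvg; rewrite fineK; last first.
  by apply: integrable_fin_num => //; apply: integrableS if_.
pose h n := (EFin \o f) \_ (`]-oo, u n]%classic).
have mf : measurable_fun setT (EFin \o f) by exact: measurable_int if_.
have [] := @dominated_convergence _ _ R mu setT measurableT h
  ((EFin \o f) \_ A) (abse \o (EFin \o f)).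
- by move=> n; apply/(measurable_restrictT _ _).1 => //; exact: measurable_funTS.
- by apply/(measurable_restrictT _ _).1 => //; exact: measurable_funTS.
- apply: aeW => t _; apply: cvg_near_cst.
  near=> n; rewrite /h !patchE; congr (if _ then _ else _).
  by near: n; exact: uA.
- exact: integrable_abse.
- apply: aeW => t n _; rewrite /h patchE; case: ifP => // _.
  by rewrite [X in (X <= _)%E]abse0 abse_ge0.
move=> _ _; rewrite /= /h.
rewrite [X in _ --> X -> _](_ : _ = \int[mu]_(t in A) (f t)%:E)%E; last first.
  by rewrite [RHS]integral_mkcond.
by move=> H; under eq_cvg => n do rewrite integral_mkcond.
Unshelve. all: by end_near. Qed.

Lemma primitive_cvgy f : mu.-integrable setT (EFin \o f) ->
  primitive f x @[x --> +oo] --> \int[mu]_x f x.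
Proof.
move=> if_; apply/cvg_pinftyP => u uoo.
apply: primitive_cvg_seq => // t; near=> n.
rewrite mem_setE in_itv/=; near: n.
by move/cvgryPge: uoo => /(_ t); apply: filterS => n ->; rewrite in_setT.
Unshelve. all: by end_near. Qed.

Lemma primitive_cvgNy f : mu.-integrable setT (EFin \o f) ->
  primitive f x @[x --> -oo] --> 0.
Proof.
move=> if_; apply/cvg_ninftyP => u uoo.
rewrite -(Rintegral_set0 mu f).
apply: primitive_cvg_seq => // t; near=> n.
rewrite mem_setE in_itv/=; near: n.
move/cvgrNyPlt: uoo => /(_ t); apply: filterS => n ut.
by rewrite in_set0 leNgt ut.
Unshelve. all: by end_near. Qed.

Lemma integral_itvy f x : mu.-integrable setT (EFin \o f) ->
  \int[mu]_(t in `[x, +oo[) f t = \int[mu]_t f t - primitive f x.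
Proof.
move=> if_; rewrite -Rintegral_itv_obnd_cbnd; last exact: integrableS if_.
have := @Rintegral_itvB _ f -oo%O +oo%O x.
by rewrite set_itvNyy => /(_ if_ isT isT) <-.
Qed.

End Primitive.

(** * Linear systems with data at minus infinity *)

Section GeometricCauchy.
Context {R : realType}.
Implicit Types (s : R^nat) (c x : R).

(** The sequences [s n -/+ 2c/2^n] are monotone, so they trap a common limit. *)
Lemma geometric_cauchy s c : (forall n, `|s n.+1 - s n| <= c / 2 ^+ n) ->
  exists l, forall n, `|l - s n| <= 2 * c / 2 ^+ n.
Proof.
move=> sc.
have half n : 2 * c / 2 ^+ n = c / 2 ^+ n + 2 * c / 2 ^+ n.+1.
  by rewrite exprS; field.
pose lo n := s n - 2 * c / 2 ^+ n; pose hi n := s n + 2 * c / 2 ^+ n.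
have ndlo : {homo lo : n m / (n <= m)%N >-> n <= m}.
  apply/nondecreasing_seqP => n; rewrite /lo (half n).
  by have := sc n; rewrite ler_norml => /andP[h1 h2]; lra.
have nihi : {homo hi : n m / (n <= m)%N >-> n >= m}.
  apply/nonincreasing_seqP => n; rewrite /hi (half n).
  by have := sc n; rewrite ler_norml => /andP[h1 h2]; lra.
have c0 : 0 <= c by have := le_trans (normr_ge0 _) (sc 0%N); rewrite expr0 divr1.
have lohi n m : lo n <= hi m.
  apply: (le_trans (ndlo _ _ (leq_maxl n m))).
  apply: (le_trans _ (nihi _ _ (leq_maxr n m))).
  by rewrite lerD2l ge0_cp// divr_ge0// ?mulr_ge0// exprn_ge0.
have clo : cvgn lo.
  by apply: nondecreasing_is_cvgn => //; exists (hi 0%N) => _ [n _ <-].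
exists (limn lo) => n; rewrite ler_distl; apply/andP; split.
  exact: nondecreasing_cvgn_le.
by apply: limr_le => //; apply: nearW => k; exact: lohi.
Qed.

Lemma cvg_div_exp2 c : c / 2 ^+ n @[n --> \oo] --> 0.
Proof.
rewrite (_ : (fun n => _) = geometric c 2^-1); first apply: cvg_geometric.
  by rewrite ger0_norm ?invr_ge0// invf_lt1// ltr1n.
by apply/funext => n; rewrite /geometric/= exprVn.
Qed.

Lemma le_geometric_eq0 x c : (forall n, `|x| <= c / 2 ^+ n) -> x = 0.
Proof.
move=> xc; apply/eqP; rewrite -normr_le0.
apply: (cvgr_to_ge (cvg_div_exp2 c)); exact: nearW.
Qed.

Lemma continuous_geometric_limit (s : nat -> R -> R) (l : R -> R) c :
  (forall n, continuous (s n)) ->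
  (forall n x, `|l x - s n x| <= c / 2 ^+ n) -> continuous l.
Proof.
move=> cs sl x; apply/cvgrPdist_le => e e0.
have e3 : 0 < e / 3 by rewrite divr_gt0.
have [n nc] : exists n, c / 2 ^+ n <= e / 3.
  have /cvgrPdist_le/(_ _ e3)[n _ /(_ n (leqnn n))] := cvg_div_exp2 c.
  by rewrite sub0r normrN => /(le_trans (ler_norm _)) ?; exists n.
have /cvgrPdist_le/(_ _ e3) := cs n x.
apply: filterS => t ht.
have h1 := le_trans (sl n x) nc; have h2 := le_trans (sl n t) nc.
have -> : l x - l t = (l x - s n x) + (s n x - s n t) - (l t - s n t) by ring.
apply: (le_trans (ler_normB _ _)); have := ler_normD (l x - s n x) (s n x - s n t).
by lra.
Qed.

End GeometricCauchy.

Section LinearSystem.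
Context {R : realType} {I : finType}.
Notation mu := (@lebesgue_measure R).
Context (m : I -> I -> R -> R) (omega : R -> R).
Context (cm : forall i j, continuous (m i j)) (comega : continuous omega)
  (iomega : mu.-integrable setT (EFin \o omega))
  (momega : forall i j x, `|m i j x| <= omega x).
Implicit Types (u : I -> R -> R) (i j : I) (x c : R).

Let N : R := #|I|%:R.

Definition linear_rhs u i x := \sum_j m i j x * u j x.

Let omega_ge0 i x : 0 <= omega x.
Proof. exact: le_trans (normr_ge0 _) (momega i i x). Qed.

Lemma continuous_linear_rhs u i :
  (forall j, continuous (u j)) -> continuous (linear_rhs u i).
Proof.
move=> cu x; apply: (@cvg_big _ _ +%R 0).
  exact: add_continuous.
by move=> j _; apply: cvgM; [exact: cm|exact: cu].
Qed.

Lemma linear_rhs_le u i x c : (forall j, `|u j x| <= c) ->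
  `|linear_rhs u i x| <= N * omega x * c.
Proof.
move=> uc; apply: (le_trans (ler_norm_sum _ _ _)).
apply: (@le_trans _ _ (\sum_(j : I) omega x * c)).
  by apply: ler_sum => j _; rewrite normrM ler_pM.
by rewrite sumr_const -mulrA mulr_natl.
Qed.

Definition weight x := expR (2 * N * primitive omega x).

Lemma is_derive_weight x : is_derive x 1 weight (weight x * (2 * N * omega x)).
Proof.
apply: is_derive_fun_expR; apply: is_derive_fun_scale.
exact: is_derive_primitive.
Qed.

Lemma weight_cvgNy : weight x @[x --> -oo] --> (1 : R).
Proof.
have h : 2 * N * primitive omega x @[x --> -oo] --> (0 : R).
  rewrite -[X in _ --> X](mulr0 (2 * N)).
  by apply: cvgMl_tmp; exact: primitive_cvgNy.
rewrite -[X in _ --> X]expR0; apply: continuous_cvg h.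
exact: continuous_expR.
Qed.

Let J := expR (2 * N * \int[mu]_x omega x).

Lemma weight_bounds i x : 1 <= weight x <= J.
Proof.
have o0 t : 0 <= omega t by exact: omega_ge0 i t.
have N0 : 0 <= 2 * N by rewrite mulr_ge0// ler0n.
apply/andP; split.
  by rewrite -expR0 ler_expR mulr_ge0// Rintegral_ge0.
rewrite ler_expR ler_wpM2l// -subr_ge0 -integral_itvy//.
by apply: Rintegral_ge0.
Qed.

(** The weight [exp (2N \int omega)] makes the Volterra operator of the system
    a contraction by the factor 1/2. *)
Lemma weighted_contraction (F : R -> R) (d : I -> R -> R) i (l : R) c :
  (forall j x, `|d j x| <= c * weight x) ->
  (forall x, is_derive x 1 F (linear_rhs d i x)) ->
  F x @[x --> -oo] --> l ->
  forall x, `|F x - l| <= c / 2 * (weight x - 1).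
Proof.
move=> dc FE Fl x; rewrite mulrBr.
have GE (t : R) : is_derive t 1 (fun t : R => c / 2 * weight t)
    (c / 2 * (weight t * (2 * N * omega t))).
  by apply: is_derive_fun_scale; exact: is_derive_weight.
apply: (le_derive_cvgNy FE GE) => //.
  move=> t; apply: (le_trans (linear_rhs_le _ _ _ _ (fun j => dc j t))).
  by rewrite le_eqVlt; apply/orP; left; apply/eqP; field.
by apply: cvgMl_tmp; exact: weight_cvgNy.
Qed.

Section Picard.
Context (a : I -> R).
Let c : R := \sum_i `|a i|.

Let c_ge0 : 0 <= c. Proof. by apply: sumr_ge0. Qed.

Let ac i : `|a i| <= c.
Proof. by rewrite /c (bigD1 i)//= lerDl sumr_ge0. Qed.

(** Volterra iteration: the base point is [-oo], where integrability of the
    coefficients makes the integral equation meaningful. *)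
Fixpoint picard n i x : R :=
  if n is n'.+1 then a i + primitive (linear_rhs (picard n') i) x else a i.

Lemma integrable_linear_rhs u i : (forall j, continuous (u j)) ->
  (forall j x, `|u j x| <= c * weight x) ->
  mu.-integrable setT (EFin \o linear_rhs u i).
Proof.
move=> cu uc.
apply: (@continuous_le_integrable _ _ (fun x => (N * (c * J)) * omega x)).
- exact: continuous_linear_rhs.
- exact: (integrableZl _ _ iomega).
move=> x; rewrite mulrAC; apply: linear_rhs_le => j.
by rewrite (le_trans (uc j x))// ler_wpM2l//; case/andP: (weight_bounds i x).
Qed.

Lemma picard_bounded n : (forall i, continuous (picard n i)) /\
  (forall i x, `|picard n i x| <= c * weight x).
Proof.
elim: n => [|n [cp pc]].
  split=> [i x|i x]; first exact: cvg_cst.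
  by rewrite (le_trans (ac i))// ler_peMr//; case/andP: (weight_bounds i x).
have dE i x : is_derive x 1 (primitive (linear_rhs (picard n) i))
    (linear_rhs (picard n) i x).
  by apply: is_derive_primitive; [exact: continuous_linear_rhs
                                 |exact: integrable_linear_rhs].
split=> [i x|i x].
  by apply: cvgD; [exact: cvg_cst|exact: (is_derive_continuous (dE i))].
have h := weighted_contraction _ _ _ 0 _ pc (dE i)
  (primitive_cvgNy _ (integrable_linear_rhs _ _ cp pc)) x.
have w1 : 1 <= weight x by case/andP: (weight_bounds i x).
rewrite /=; apply: (le_trans (ler_normD _ _)).
move: h; rewrite subr0 => h; apply: (le_trans (lerD (ac i) h)).
have : 0 <= c * (weight x - 1) by rewrite mulr_ge0// subr_ge0.
by lra.
Qed.

Lemma is_derive_picard n i x :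
  is_derive x 1 (picard n.+1 i) (linear_rhs (picard n) i x).
Proof.
have [cp pc] := picard_bounded n.
have dE : is_derive x 1 (primitive (linear_rhs (picard n) i))
    (linear_rhs (picard n) i x).
  by apply: is_derive_primitive; [exact: continuous_linear_rhs
                                 |exact: integrable_linear_rhs].
have := is_derive_fun_add (is_derive_cst (a i) x 1) dE.
by rewrite add0r.
Qed.

Lemma picard_cvgNy n i : picard n i x @[x --> -oo] --> a i.
Proof.
case: n => [|n]; first exact: cvg_cst.
have [cp pc] := picard_bounded n.
rewrite -[X in _ --> X]addr0; apply: cvgD; first exact: cvg_cst.
by apply: primitive_cvgNy; exact: integrable_linear_rhs.
Qed.

Lemma linear_rhsB u v i x : linear_rhs u i x - linear_rhs v i x =
  linear_rhs (fun j t => u j t - v j t) i x.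
Proof. by rewrite /linear_rhs -sumrB; apply: eq_bigr => j _; rewrite mulrBr. Qed.

Lemma picard_step n i x :
  `|picard n.+1 i x - picard n i x| <= c / 2 ^+ n * weight x.
Proof.
elim: n i x => [|n IH] i x.
  have := weighted_contraction _ _ _ _ _ (picard_bounded 0).2
    (is_derive_picard 0 i) (picard_cvgNy 1 i) x.
  have w1 : 1 <= weight x by case/andP: (weight_bounds i x).
  have : 0 <= c * weight x by rewrite mulr_ge0// (le_trans _ w1).
  by rewrite expr0; move: c_ge0; lra.
have dE (t : R) : is_derive t 1 (fun t : R => picard n.+2 i t - picard n.+1 i t)
    (linear_rhs (fun j t => picard n.+1 j t - picard n j t) i t).
  rewrite -linear_rhsB; apply: is_derive_fun_sub; exact: is_derive_picard.
have l0 : picard n.+2 i t - picard n.+1 i t @[t --> -oo] --> a i - a i.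
  by apply: cvgB; exact: picard_cvgNy.
have := weighted_contraction _ _ _ _ _ IH dE l0 x.
rewrite subrr subr0 => /le_trans; apply.
have -> : c / 2 ^+ n.+1 = c / 2 ^+ n / 2 by rewrite exprS; field.
rewrite ler_wpM2l ?gerBl//; apply: divr_ge0 => //.
by apply: divr_ge0 => //; exact: exprn_ge0.
Qed.

(** The Picard iterates converge geometrically, uniformly on the line, because
    the weight is bounded; the uniform limit inherits continuity and solves the
    integral equation.  The explicit bound depends on the coefficients only
    through [omega], which is what makes later estimates uniform in [k]. *)
Theorem linear_system_solution : exists u : I -> R -> R,
  [/\ forall i x, is_derive x 1 (u i) (linear_rhs u i x),
      forall i, u i x @[x --> -oo] --> a i,
      forall i, cvg (u i x @[x --> +oo]) &
      forall i x, `|u i x| <= c * J].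
Proof.
have cJ n : 0 <= c / 2 ^+ n by rewrite divr_ge0// exprn_ge0.
have stepJ n i x : `|picard n.+1 i x - picard n i x| <= c * J / 2 ^+ n.
  rewrite mulrAC (le_trans (picard_step n i x))// ler_wpM2l//.
  by case/andP: (weight_bounds i x).
have lim_ex i x : exists l, forall n, `|l - picard n i x| <= 2 * (c * J) / 2 ^+ n.
  apply: (geometric_cauchy (fun n => picard n i x)) => n; exact: stepJ.
pose u i x := projT1 (cid (lim_ex i x)).
have uP i x n : `|u i x - picard n i x| <= 2 * (c * J) / 2 ^+ n.
  exact: (projT2 (cid (lim_ex i x))).
have cu i : continuous (u i).
  apply: (continuous_geometric_limit (fun n => picard n i)) => [n|n x].
    exact: (picard_bounded n).1.
  exact: uP.
have uc i x : `|u i x| <= c * weight x.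
  rewrite -[_ * weight x]addr0.
  apply: (@cvgr_to_ge _ \oo _ _ (fun n => c * weight x + 2 * (c * J) / 2 ^+ n)).
    by apply: cvgD; [exact: cvg_cst|exact: cvg_div_exp2].
  apply: nearW => n; rewrite -[u i x](subrK (picard n i x)) addrC.
  by apply: (le_trans (ler_normD _ _)); apply: lerD; [exact: (picard_bounded n).2|].
have iu i := integrable_linear_rhs u i cu uc.
have dE i x : is_derive x 1 (primitive (linear_rhs u i)) (linear_rhs u i x).
  by apply: is_derive_primitive; [exact: continuous_linear_rhs|].
have uE i : u i = fun x => a i + primitive (linear_rhs u i) x.
  apply/funext => x; apply/eqP; rewrite -subr_eq0; apply/eqP.
  apply: (le_geometric_eq0 _ (c * J * J)) => n.
  have du j t : `|picard n j t - u j t| <= 2 * (c * J) / 2 ^+ n * weight t.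
    rewrite distrC (le_trans (uP j t n))// ler_peMr//; last first.
      by case/andP: (weight_bounds i t).
    by rewrite divr_ge0 ?exprn_ge0// !mulr_ge0// expR_ge0.
  have dF (t : R) : is_derive t 1
      (fun t : R => picard n.+1 i t - primitive (linear_rhs u i) t)
      (linear_rhs (fun j t => picard n j t - u j t) i t).
    rewrite -linear_rhsB.
    exact: (is_derive_fun_sub (is_derive_picard n i t) (dE i t)).
  have l0 : picard n.+1 i t - primitive (linear_rhs u i) t @[t --> -oo] -->
      a i - 0.
    by apply: cvgB; [exact: picard_cvgNy|exact: primitive_cvgNy].
  have := weighted_contraction _ _ _ _ _ du dF l0 x.
  rewrite subr0 => h.
  have -> : u i x - (a i + primitive (linear_rhs u i) x) =
    (u i x - picard n.+1 i x) +
    (picard n.+1 i x - primitive (linear_rhs u i) x - a i) by ring.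
  apply: (le_trans (ler_normD _ _)); apply: (le_trans (lerD (uP i x n.+1) h)).
  have -> : 2 * (c * J) / 2 ^+ n.+1 + 2 * (c * J) / 2 ^+ n / 2 * (weight x - 1) =
    c * J / 2 ^+ n * weight x by rewrite exprS; field.
  rewrite [leRHS]mulrAC ler_wpM2l//; last by case/andP: (weight_bounds i x).
  by rewrite mulrAC; apply: mulr_ge0; [exact: cJ|exact: expR_ge0].
exists u; split.
- move=> i x; rewrite [X in is_derive _ _ X _]uE.
  have := is_derive_fun_add (is_derive_cst (a i) x 1) (dE i x).
  by rewrite add0r.
- move=> i; rewrite uE -[X in _ --> X]addr0; apply: cvgD; first exact: cvg_cst.
  exact: primitive_cvgNy.
- move=> i; rewrite uE; apply: is_cvgD; first exact: is_cvg_cst.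
  by apply/cvg_ex; eexists; exact: primitive_cvgy.
- move=> i x; apply: (le_trans (uc i x)); apply: ler_wpM2l => //.
  by case/andP: (weight_bounds i x).
Qed.

End Picard.
End LinearSystem.

(** * The first order system behind the Miura factorization *)

Section ZakharovShabat.
Context {R : realType}.
Notation mu := (@lebesgue_measure R).
Implicit Types (w al be y v : R -> R) (a b k x : R).

Lemma normr_sin_le x : `|sin x| <= `|x|.
Proof.
have pos (z : R) : 0 <= z -> `|sin z| <= z.
  move=> z0; have [c _] := MVT_segment z0 (fun t _ => is_derive_sin t)
    (continuous_subspaceT (@continuous_sin R)).
  rewrite sin0 !subr0 => ->; rewrite normrM (ger0_norm z0) ler_piMl//.
  exact: cos_max.
have [x0|x0] := leP 0 x; first by rewrite (ger0_norm x0) pos.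
by rewrite -normrN -sinN (ltr0_norm x0) pos// oppr_ge0 ltW.
Qed.

Lemma one_sub_cos_le x : `|1 - cos x| <= `|x|.
Proof.
have -> : 1 - cos x = 2 * sin (x / 2) ^+ 2.
  have {1}-> : x = (x / 2) *+ 2 by rewrite mulr2n; field.
  by rewrite cos_mulr2n mulr2n sin2cos2; ring.
have s1 : `|sin (x / 2)| <= 1 by exact: sin_max.
have s2 : `|sin (x / 2)| <= `|x| / 2.
  by rewrite (le_trans (normr_sin_le _))// normrM normfV (ger0_norm (ler0n _ 2)).
rewrite normrM normrX ger0_norm//.
have : `|sin (x / 2)| * `|sin (x / 2)| <= 1 * (`|x| / 2) by rewrite ler_pM.
by rewrite expr2; lra.
Qed.

(** With [y' + w y = k v] and [- v' + w v = k y], the rotated amplitude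
    [al + i be = exp (ikx) (y + iv)] solves this first order system.  Its
    coefficients are integrable, so [al] and [be] have limits at both ends:
    these are the amplitudes of [cos (kx)] and [sin (kx)] in [y]. *)
Definition zs_solution w k al be :=
  (forall x, is_derive x 1 al
     (- w x * (cos (2 * k * x) * al x + sin (2 * k * x) * be x))) /\
  (forall x, is_derive x 1 be
     (- w x * (sin (2 * k * x) * al x - cos (2 * k * x) * be x))).

(** [wave] and [wave_conj] are the real and imaginary parts of
    [exp (- ikx) (al + i be)], that is [y] and [v] above. *)
Definition wave k al be x := cos (k * x) * al x + sin (k * x) * be x.

Definition wave_conj k al be x := cos (k * x) * be x - sin (k * x) * al x.

Lemma is_derive_cos_scale k x :
  is_derive x 1 (fun t : R => cos (k * t)) (- k * sin (k * x)).
Proof.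
have := is_derive1_comp (f := cos) (g := *%R k) (is_derive_cos (k * x)) 
  (is_derive_fun_scale k (is_derive_id x 1)).
by rewrite mulr1 mulNr mulrC mulNr.
Qed.

Lemma is_derive_sin_scale k x :
  is_derive x 1 (fun t : R => sin (k * t)) (k * cos (k * x)).
Proof.
have := is_derive1_comp (f := sin) (g := *%R k) (is_derive_sin (k * x)) 
  (is_derive_fun_scale k (is_derive_id x 1)).
by rewrite mulr1 mulrC.
Qed.

Lemma cos_sin_double k x :
  cos (2 * k * x) = cos (k * x) ^+ 2 - sin (k * x) ^+ 2 /\
  sin (2 * k * x) = 2 * (sin (k * x) * cos (k * x)).
Proof.
have -> : 2 * k * x = k * x + k * x by ring.
by rewrite cosD sinD; split; ring.
Qed.

Lemma is_derive_wave {w k al be} : zs_solution w k al be ->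
  forall x, is_derive x 1 (wave k al be)
    (- w x * wave k al be x + k * wave_conj k al be x).
Proof.
move=> [dal dbe] x.
apply: is_derive_eq (is_derive_fun_add
  (is_derive_fun_mul (is_derive_cos_scale k x) (dal x))
  (is_derive_fun_mul (is_derive_sin_scale k x) (dbe x))) _.
have [-> ->] := cos_sin_double k x; have := cos2Dsin2 (k * x).
rewrite /wave /wave_conj => h.
transitivity (- w x * ((cos (k * x) ^+ 2 + sin (k * x) ^+ 2) *
    (cos (k * x) * al x + sin (k * x) * be x)) +
  k * (cos (k * x) * be x - sin (k * x) * al x)); first ring.
by rewrite h mul1r.
Qed.

Lemma is_derive_wave_conj {w k al be} : zs_solution w k al be ->
  forall x, is_derive x 1 (wave_conj k al be)
    (w x * wave_conj k al be x - k * wave k al be x).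
Proof.
move=> [dal dbe] x.
apply: is_derive_eq (is_derive_fun_sub
  (is_derive_fun_mul (is_derive_cos_scale k x) (dbe x))
  (is_derive_fun_mul (is_derive_sin_scale k x) (dal x))) _.
have [-> ->] := cos_sin_double k x; have := cos2Dsin2 (k * x).
rewrite /wave /wave_conj => h.
transitivity (w x * ((cos (k * x) ^+ 2 + sin (k * x) ^+ 2) *
    (cos (k * x) * be x - sin (k * x) * al x)) -
  k * (cos (k * x) * al x + sin (k * x) * be x)); first ring.
by rewrite h mul1r.
Qed.

End ZakharovShabat.

Section Transfer.
Context {R : realType}.
Notation mu := (@lebesgue_measure R).
Context (w : R -> R) (cw : continuous w)
  (iw : mu.-integrable setT (EFin \o w))
  (ixw : mu.-integrable setT (EFin \o (fun x : R => x * w x))).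
Implicit Types (al be u v : R -> R) (a b k x s c : R).

Let I := \int[mu]_x w x.
Let L := \int[mu]_x `|w x|.
Let N1 := \int[mu]_x `|x * w x|.

Lemma continuous_norm_fun (f : R -> R) :
  continuous f -> continuous (fun x => `|f x|).
Proof. by move=> cf x; apply: cvg_norm; exact: cf. Qed.

Let inw : mu.-integrable setT (EFin \o (fun x => `|w x|)).
Proof. exact: integrable_norm iw. Qed.

Let inxw : mu.-integrable setT (EFin \o (fun x : R => `|x * w x|)).
Proof. exact: integrable_norm ixw. Qed.

Lemma normr_integral_le : `|I| <= L.
Proof. exact: le_normr_Rintegral. Qed.

Lemma le_primitive_integral (f : R -> R) x :
  (forall x, 0 <= f x) -> mu.-integrable setT (EFin \o f) ->
  primitive f x <= \int[mu]_x f x.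
Proof.
move=> f0 if_; rewrite -subr_ge0 -integral_itvy//.
by apply: Rintegral_ge0.
Qed.

Lemma normr_primitive_le x : `|primitive w x| <= L.
Proof.
apply: le_trans (le_primitive_integral _ x (fun x => normr_ge0 (w x)) inw).
by apply: le_normr_Rintegral => //; exact: integrableS iw.
Qed.

(** At [k = 0] the system is diagonal and [u exp (s \int w)] is constant; for
    small [k] its derivative is at most a multiple of [|k x w(x)|].  The two
    components are the cases [s = 1] and [s = -1]. *)
Lemma small_momentum s k c u v (u0 u1 : R) : s ^+ 2 = 1 ->
  (forall x, is_derive x 1 u
     (- w x * (s * cos (2 * k * x) * u x + sin (2 * k * x) * v x))) ->
  (forall x, `|u x| <= c) -> (forall x, `|v x| <= c) ->
  u x @[x --> -oo] --> u0 -> u x @[x --> +oo] --> u1 ->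
  `|u1 - expR (- s * I) * u0| <= 4 * c * expR (2 * L) * N1 * `|k|.
Proof.
move=> s1 du uc vc lu0 lu1.
have ns : `|s| = 1.
  by move/eqP: s1; rewrite sqrf_eq1 => /orP[]/eqP ->; rewrite ?normrN normr1.
have c0 : 0 <= c := le_trans (normr_ge0 _) (uc 0).
have dW x : is_derive x 1 (primitive w) (w x) by exact: is_derive_primitive.
have dF x := is_derive_fun_mul
  (is_derive_fun_expR (is_derive_fun_scale s (dW x))) (du x).
have dG x : is_derive x 1
    (fun x : R => 4 * c * expR L * `|k| * primitive (fun x => `|x * w x|) x)
    (4 * c * expR L * `|k| * `|x * w x|).
  apply: is_derive_fun_scale; apply: is_derive_primitive => //.
  apply: continuous_norm_fun => t; apply: cvgM; [exact: cvg_id|exact: cw].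
have lW : s * primitive w x @[x --> -oo] --> (0 : R).
  by rewrite -[X in _ --> X](mulr0 s); apply: cvgMl_tmp; exact: primitive_cvgNy.
have lF : expR (s * primitive w x) * u x @[x --> -oo] --> u0.
  rewrite -[X in _ --> X]mul1r -expR0; apply: cvgM => //.
  by apply: continuous_cvg lW; exact: continuous_expR.
have lG : 4 * c * expR L * `|k| * primitive (fun x => `|x * w x|) x
    @[x --> -oo] --> (0 : R).
  rewrite -[X in _ --> X](mulr0 (4 * c * expR L * `|k|)).
  by apply: cvgMl_tmp; exact: primitive_cvgNy.
have le x : `|expR (s * primitive w x) * (s * w x) * u x +
    expR (s * primitive w x) *
    (- w x * (s * cos (2 * k * x) * u x + sin (2 * k * x) * v x))|
    <= 4 * c * expR L * `|k| * `|x * w x|.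
  have -> : expR (s * primitive w x) * (s * w x) * u x +
    expR (s * primitive w x) *
    (- w x * (s * cos (2 * k * x) * u x + sin (2 * k * x) * v x)) =
    expR (s * primitive w x) * (w x *
      (s * ((1 - cos (2 * k * x)) * u x) - sin (2 * k * x) * v x)) by ring.
  have eL : expR (s * primitive w x) <= expR L.
    rewrite ler_expR (le_trans (ler_norm _))// normrM ns mul1r.
    exact: normr_primitive_le.
  have kx : `|2 * k * x| = 2 * `|k| * `|x| by rewrite !normrM ger0_norm.
  have h1 : `|(1 - cos (2 * k * x)) * u x| <= 2 * `|k| * `|x| * c.
    by rewrite normrM ler_pM// -kx; exact: one_sub_cos_le.
  have h2 : `|sin (2 * k * x) * v x| <= 2 * `|k| * `|x| * c.
    by rewrite normrM ler_pM// -kx; exact: normr_sin_le.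
  rewrite normrM ger0_norm ?expR_ge0//.
  have h3 : `|w x * (s * ((1 - cos (2 * k * x)) * u x) - sin (2 * k * x) * v x)|
      <= `|w x| * (4 * `|k| * `|x| * c).
    rewrite normrM ler_wpM2l//; apply: (le_trans (ler_normB _ _)).
    by rewrite normrM ns mul1r; lra.
  apply: (le_trans (ler_pM _ _ eL h3)); rewrite ?expR_ge0//.
  by rewrite normrM le_eqVlt; apply/orP; left; apply/eqP; ring.
have bound x : `|expR (s * primitive w x) * u x - u0| <= 4 * c * expR L * `|k| * N1.
  have := le_derive_cvgNy dF dG le lF lG x.
  rewrite subr0 => /le_trans; apply; rewrite ler_wpM2l//.
    by rewrite !mulr_ge0 ?expR_ge0.
  exact: le_primitive_integral.
have lWy : s * primitive w x @[x --> +oo] --> s * I.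
  by apply: cvgMl_tmp; exact: primitive_cvgy.
have lFy : `|expR (s * primitive w x) * u x - u0| @[x --> +oo] -->
    `|expR (s * I) * u1 - u0|.
  apply: cvg_norm; apply: cvgB; last exact: cvg_cst.
  apply: cvgM => //.
  by apply: continuous_cvg lWy; exact: continuous_expR.
have h : `|expR (s * I) * u1 - u0| <= 4 * c * expR L * `|k| * N1.
  by apply: (cvgr_to_le lFy); exact: nearW.
have -> : u1 - expR (- s * I) * u0 = expR (- s * I) * (expR (s * I) * u1 - u0).
  by rewrite mulrBr mulrA -expRD mulNr addNr expR0 mul1r.
rewrite normrM ger0_norm ?expR_ge0//.
have eI : expR (- s * I) <= expR L.
  rewrite ler_expR (le_trans (ler_norm _))// normrM normrN ns mul1r.
  exact: normr_integral_le.
apply: (le_trans (ler_pM (expR_ge0 _) (normr_ge0 _) eI h)).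
have -> : 2 * L = L + L by ring.
by rewrite expRD le_eqVlt; apply/orP; left; apply/eqP; ring.
Qed.

Definition zs_connects k al be (a b a' b' : R) :=
  [/\ zs_solution w k al be, al x @[x --> -oo] --> a, be x @[x --> -oo] --> b,
      al x @[x --> +oo] --> a' & be x @[x --> +oo] --> b'].

Lemma zs_solution_exists k a b : exists al be a' b',
  zs_connects k al be a b a' b' /\
  (forall x, `|al x| <= (`|a| + `|b|) * expR (4 * L)) /\
  (forall x, `|be x| <= (`|a| + `|b|) * expR (4 * L)).
Proof.
(* index [true] stands for the component [al], [false] for [be] *)
pose e (i j : bool) (x : R) :=
  if i && j then cos (2 * k * x) else if i || j then sin (2 * k * x)
  else - cos (2 * k * x).
pose m i j x := - w x * e i j x.
have ck : continuous (fun x : R => 2 * k * x).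
  by move=> x; apply: cvgMl_tmp; exact: cvg_id.
have ccos : continuous (fun x : R => cos (2 * k * x)).
  by move=> x; apply: continuous_cvg (ck x); exact: continuous_cos.
have csin : continuous (fun x : R => sin (2 * k * x)).
  by move=> x; apply: continuous_cvg (ck x); exact: continuous_sin.
have ce i j : continuous (e i j).
  rewrite /e; case: i; case: j => //= x.
  by apply: cvgN; exact: ccos.
have cm i j : continuous (m i j).
  by move=> x; apply: cvgM; [apply: cvgN; exact: cw|exact: ce].
have mw i j x : `|m i j x| <= `|w x|.
  rewrite normrM normrN ler_piMr// /e.
  by case: i; case: j => /=; rewrite ?normrN ?cos_max ?sin_max.
have [u [du ul uy ub]] := linear_system_solution m (fun x => `|w x|) cm
  (continuous_norm_fun _ cw) inw mw (fun i => if i then a else b).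
have rE i x : linear_rhs m u i x = m i true x * u true x + m i false x * u false x.
  by rewrite /linear_rhs big_bool.
have ub' i x : `|u i x| <= (`|a| + `|b|) * expR (4 * L).
  move: (ub i x); rewrite big_bool card_bool/=.
  by have -> : 2 * 2 = 4 :> R by ring.
exists (u true), (u false), (lim (u true x @[x --> +oo])), (lim (u false x @[x --> +oo])).
split; last by [].
split; [|exact: (ul true)|exact: (ul false)|exact: uy|exact: uy].
split=> x.
- by apply: is_derive_eq (du true x) _; rewrite rE /m /e/=; ring.
- by apply: is_derive_eq (du false x) _; rewrite rE /m /e/=; ring.
Qed.

(** As [k -> 0] the transfer across the line tends to
    [diag (exp (- I), exp I)]. *)
Lemma zs_connection : exists M, forall k a b, exists al be a' b',
  [/\ zs_connects k al be a b a' b',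
      `|a' - expR (- I) * a| <= M * (`|a| + `|b|) * `|k| &
      `|b' - expR I * b| <= M * (`|a| + `|b|) * `|k|].
Proof.
exists (4 * expR (4 * L) * expR (2 * L) * N1) => k a b.
have [al [be [a' [b' [co [ba bb]]]]]] := zs_solution_exists k a b.
exists al, be, a', b'; have [[dal dbe] la lb la' lb'] := co; split=> //.
- have := small_momentum 1 k _ al be a a' (expr1n _ 2) _ ba bb la la'.
  rewrite !mulN1r; move=> h; apply: le_trans (h _) _.
    by move=> x; rewrite mul1r; exact: dal.
  by rewrite le_eqVlt; apply/orP; left; apply/eqP; ring.
- have s1 : (-1 : R) ^+ 2 = 1 by rewrite sqrrN expr1n.
  have := small_momentum (-1) k _ be al b b' s1 _ bb ba lb lb'.
  rewrite opprK mul1r; move=> h; apply: le_trans (h _) _.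
    by move=> x; apply: is_derive_eq (dbe x) _; ring.
  by rewrite le_eqVlt; apply/orP; left; apply/eqP; ring.
Qed.

(** The coefficient matrix is trace free, so the Wronskian is conserved. *)
Lemma zs_det {k al1 be1 al2 be2 a1 b1 a1' b1' a2 b2 a2' b2'} :
  zs_connects k al1 be1 a1 b1 a1' b1' -> zs_connects k al2 be2 a2 b2 a2' b2' ->
  (forall x, al1 x * be2 x - al2 x * be1 x = a1 * b2 - a2 * b1) /\
  a1' * b2' - a2' * b1' = a1 * b2 - a2 * b1.
Proof.
move=> [[da1 db1] la1 lb1 la1' lb1'] [[da2 db2] la2 lb2 la2' lb2'].
pose D x := al1 x * be2 x - al2 x * be1 x.
have dD x : is_derive x 1 D 0.
  apply: is_derive_eq (is_derive_fun_sub (is_derive_fun_mul (da1 x) (db2 x))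
    (is_derive_fun_mul (da2 x) (db1 x))) _.
  by ring.
have lD : D x @[x --> -oo] --> a1 * b2 - a2 * b1.
  by apply: cvgB; apply: cvgM.
have lD' : D x @[x --> +oo] --> a1' * b2' - a2' * b1'.
  by apply: cvgB; apply: cvgM.
have DE x : D x = D 0 by exact: is_derive_0_is_cst.
have D0 : D = cst (D 0) by apply/funext.
have e : D 0 = a1 * b2 - a2 * b1.
  by apply: (cvg_unique (@Rhausdorff R) _ lD); rewrite D0; exact: cvg_cst.
have e' : D 0 = a1' * b2' - a2' * b1'.
  by apply: (cvg_unique (@Rhausdorff R) _ lD'); rewrite D0; exact: cvg_cst.
by split=> [x|]; [exact: etrans (DE x) e|exact: etrans (esym e') e].
Qed.

End Transfer.

(** * Schwartz potentials and real solutions *)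

Section SchwartzFacts.
Context {R : realType}.
Notation mu := (@lebesgue_measure R).

Lemma integrable_oneDsqrV : mu.-integrable setT (EFin \o (fun x : R => (oneDsqr x)^-1)).
Proof.
have p0 (x : R) : 0 <= (oneDsqr x)^-1 by rewrite invr_ge0 (le_trans _ (oneDsqr_ge1 x)).
apply/integrableP; split.
  apply/measurable_EFinP; apply: continuous_measurable_fun.
  exact: continuous_oneDsqrV.
under eq_integral => x _ do rewrite gee0_abs ?lee_fin//=.
rewrite (ge0_symfun_integralT p0); first last.
- by move=> x; rewrite /oneDsqr /= sqrrN.
- exact: continuous_oneDsqrV.
by rewrite -set_itvcy integral0y_oneDsqr -EFinM ltry.
Qed.

(** Two polynomial bounds compare [f] with [1 / (1 + x ^ 2)]. *)
Lemma decay_integrable (f : R -> R) (c0 c2 : R) : continuous f ->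
  (forall x, `|f x| <= c0) -> (forall x, `|x ^+ 2 * f x| <= c2) ->
  mu.-integrable setT (EFin \o f).
Proof.
move=> cf f0 f2.
apply: (@continuous_le_integrable _ _ (fun x => (c0 + c2) * (oneDsqr x)^-1)) => //.
  exact: (integrableZl _ _ integrable_oneDsqrV).
move=> x; rewrite ler_pdivlMr; last by rewrite (lt_le_trans _ (oneDsqr_ge1 x)).
have := f2 x; rewrite normrM (@ger0_norm _ (x ^+ 2)) ?sqr_ge0// => h.
by have := f0 x; rewrite /oneDsqr mulrDr mulr1 (mulrC `|f x|); lra.
Qed.

Context (w : R -> R) (hw : schwartz w).

Lemma schwartz_is_derive (x : R) : is_derive x 1 w (derive1 w x).
Proof. by rewrite derive1E; apply/derivableP; exact: (hw.1 0%N). Qed.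

Lemma schwartz_continuous : continuous w.
Proof. exact: is_derive_continuous schwartz_is_derive. Qed.

Lemma schwartz_derive_continuous : continuous (derive1 w).
Proof.
move=> x; apply/differentiable_continuous/derivable1_diffP.
by have := hw.1 1%N x; rewrite derive1n1.
Qed.

Lemma schwartz_bounded : exists c : R, forall x, `|w x| <= c.
Proof.
by have [c h] := hw.2 0%N 0%N; exists c => x; have := h x; rewrite expr0 mul1r.
Qed.

Lemma schwartz_derive_bounded : exists c : R, forall x, `|derive1 w x| <= c.
Proof.
have [c h] := hw.2 0%N 1%N; exists c => x.
by have := h x; rewrite derive1n1 expr0 mul1r.
Qed.

Lemma schwartz_integrable : mu.-integrable setT (EFin \o w).
Proof.
have [c0 h0] := hw.2 0%N 0%N; have [c2 h2] := hw.2 2%N 0%N.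
apply: (decay_integrable _ c0 c2) => // [|x]; first exact: schwartz_continuous.
by have := h0 x; rewrite expr0 mul1r.
Qed.

Lemma schwartz_mul_integrable :
  mu.-integrable setT (EFin \o (fun x : R => x * w x)).
Proof.
have [c1 h1] := hw.2 1%N 0%N; have [c3 h3] := hw.2 3%N 0%N.
apply: (decay_integrable _ c1 c3) => [x|x|x].
- by apply: cvgM; [exact: cvg_id|exact: schwartz_continuous].
- by have := h1 x; rewrite expr1.
- by have := h3 x; rewrite exprSr mulrA.
Qed.

Definition miura (x : R) : R := derive1 w x - w x ^+ 2.

Lemma miura_bounded : exists c : R, forall x, `|miura x| <= c.
Proof.
have [c h] := schwartz_bounded; have [d h'] := schwartz_derive_bounded.
exists (d + c ^+ 2) => x; apply: (le_trans (ler_normB _ _)); apply: lerD => //.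
by rewrite normrX lerXn2r// ?nnegrE// (le_trans _ (h x)).
Qed.

End SchwartzFacts.

Section RealSolutions.
Context {R : realType}.
Implicit Types (q y z dy u : R -> R) (e a b x : R).

Definition real_solution q e y := forall x,
  [/\ derivable y x 1, derivable (derive1 y) x 1 &
    - derive1 (derive1 y) x - q x * y x = e * y x].

Lemma is_derive_derive1 {y dy} : (forall x, is_derive x 1 y (dy x)) -> (derive1 y) = dy.
Proof. by move=> yd; apply/funext => x; rewrite derive1E derive_val. Qed.

Lemma real_solutionI q e y dy : (forall x, is_derive x 1 y (dy x)) ->
  (forall x, is_derive x 1 dy (- (q x + e) * y x)) -> real_solution q e y.
Proof.
move=> yd dyd x; rewrite (is_derive_derive1 yd) (is_derive_derive1 dyd).
split; [by case: (yd x)|by case: (dyd x)|ring].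
Qed.

Lemma real_solution_derive {q e y} : real_solution q e y ->
  (forall x, is_derive x 1 y (derive1 y x)) /\
  (forall x, is_derive x 1 (derive1 y) (- (q x + e) * y x)).
Proof.
move=> ys; split=> x; have [d1 d2 eq] := ys x.
  by rewrite derive1E; exact/derivableP.
have -> : - (q x + e) * y x = derive1 (derive1 y) x by lra.
by rewrite [in X in is_derive _ _ _ X]derive1E; exact/derivableP.
Qed.

Lemma real_solution_lin {q e y z} a b :
  real_solution q e y -> real_solution q e z ->
  real_solution q e (fun x => a * y x + b * z x).
Proof.
move=> /real_solution_derive[y1 y2] /real_solution_derive[z1 z2].
apply: (real_solutionI _ _ _ (fun x => a * derive1 y x + b * derive1 z x)) => x.
apply: is_derive_eq (is_derive_fun_add (is_derive_fun_scale a (y2 x))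
    (is_derive_fun_scale b (z2 x))) _.
by ring.
Qed.

Lemma wronskian_const {q e y z} : real_solution q e y -> real_solution q e z ->
  exists c : R, forall x, y x * derive1 z x - derive1 y x * z x = c.
Proof.
move=> /real_solution_derive[y1 y2] /real_solution_derive[z1 z2].
pose W x := y x * derive1 z x - derive1 y x * z x.
have dW x : is_derive x 1 W 0.
  apply: is_derive_eq (is_derive_fun_sub (is_derive_fun_mul (y1 x) (z2 x))
    (is_derive_fun_mul (y2 x) (z1 x))) _.
  by ring.
by exists (W 0) => x; exact: is_derive_0_is_cst.
Qed.

(** The property shared by the filters [+oo] and [-oo] on which the decay
    arguments depend: an eventual property holds eventually on unit segments. *)
Definition unit_stable (F : set_system R) := forall P : set R, F P ->
  F [set x | forall t, x <= t <= x + 1 -> P t].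

Lemma unit_stable_pinfty : unit_stable +oo.
Proof.
move=> P [M [Mr MP]]; exists M; split=> // x Mx t /andP[xt _].
by apply: MP; exact: lt_le_trans xt.
Qed.

Lemma unit_stable_ninfty : unit_stable -oo.
Proof.
move=> P [M [Mr MP]]; exists (M - 1); split; first exact: num_real.
move=> x xM t /andP[_ tx]; apply: MP; apply: le_lt_trans tx _.
by rewrite -ltrBrDr.
Qed.

Lemma cvg0_bounded_mul (F : set_system R) {FF : Filter F} (f g : R -> R) (d : R) :
  (forall x, `|f x| <= d) -> g x @[x --> F] --> (0 : R) ->
  f x * g x @[x --> F] --> (0 : R).
Proof.
move=> fd /cvgr0Pnorm_le g0; apply/cvgr0Pnorm_le => eps eps0.
have d0 : 0 <= d := le_trans (normr_ge0 _) (fd 0).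
have e0 : 0 < eps / (d + 1) by rewrite divr_gt0// ltr_wpDl.
apply: filterS (g0 _ e0) => t ht; rewrite normrM.
apply: (le_trans (ler_pM _ _ (fd t) ht)) => //.
by rewrite mulrCA ler_piMr ?ltW// ltr_pdivrMr ?mul1r ?ltrDl// ltr_wpDl.
Qed.

(** By the equation [u''] is small with [u], and the mean value theorem on a unit
    segment then makes [u'] small. *)
Lemma solution_derive_cvg0 (F : set_system R) {FF : Filter F} q e u c :
  unit_stable F -> (forall x, `|q x| <= c) -> real_solution q e u ->
  u x @[x --> F] --> (0 : R) -> derive1 u x @[x --> F] --> (0 : R).
Proof.
move=> stF qc /real_solution_derive[u1 u2] u0.
have c0 : 0 <= c := le_trans (normr_ge0 _) (qc 0).
have C0 : 0 < 2 + c + `|e| by have := normr_ge0 e; lra.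
apply/cvgr0Pnorm_le => eps eps0.
have d0 : 0 < eps / (2 + c + `|e|) by rewrite divr_gt0.
have /cvgr0Pnorm_le/(_ _ d0)/stF := u0; apply: filterS => x xP.
set d := eps / _ in d0 xP.
have x1 : x <= x + 1 by rewrite lerDl.
have [s sI us] := MVT_segment x1 (fun t _ => u1 t)
  (continuous_subspaceT (is_derive_continuous u1)).
move: sI; rewrite in_itv/= => /andP[xs sx].
have [r rI ur] := MVT_segment xs (fun t _ => u2 t)
  (continuous_subspaceT (is_derive_continuous u2)).
move: rI; rewrite in_itv/= => /andP[xr rs].
have -> : derive1 u x = u (x + 1) - u x + (q r + e) * u r * (s - x).
  by rewrite us -[_ + e]opprK mulNr mulNr -ur; ring.
have h1 : `|u (x + 1)| <= d by apply: xP; rewrite x1 lexx.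
have h2 : `|u x| <= d by apply: xP; rewrite x1 lexx.
have h3 : `|u r| <= d by apply: xP; rewrite xr (le_trans rs).
have h4 : `|(q r + e) * u r * (s - x)| <= (c + `|e|) * d.
  have sx1 : `|s - x| <= 1 by rewrite ger0_norm; lra.
  rewrite -[leRHS]mulr1 !normrM ler_pM// ler_pM//.
  by rewrite (le_trans (ler_normD _ _))// lerD2r.
have -> : eps = (2 + c + `|e|) * d by rewrite /d mulrC divfK// gt_eqF.
apply: (le_trans (ler_normD _ _)); have := ler_normB (u (x + 1)) (u x).
by lra.
Qed.

(** The Wronskian is conserved, and a bounded factor against a vanishing one makes
    it tend to zero along [F]. *)
Lemma wronskian_eq0 (F : set_system R) {FF : ProperFilter F} q e y z c :
  unit_stable F -> (forall x, `|q x| <= c) ->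
  real_solution q e y -> real_solution q e z ->
  (exists d : R, forall x, `|y x| <= d) -> (exists d : R, forall x, `|derive1 y x| <= d) ->
  z x @[x --> F] --> (0 : R) ->
  forall x, y x * derive1 z x = derive1 y x * z x.
Proof.
move=> stF qc ys zs yb y'b z0 x.
have z'0 : derive1 z t @[t --> F] --> (0 : R).
  exact: (solution_derive_cvg0 F q e z c).
have [k Wk] := wronskian_const ys zs.
have b0 (f g : R -> R) : (exists d : R, forall x, `|f x| <= d) ->
    g x @[x --> F] --> (0 : R) -> f x * g x @[x --> F] --> (0 : R).
  by move=> [d fd]; exact: (cvg0_bounded_mul _ _ _ d fd).
have Wk_cvg : y t * derive1 z t - derive1 y t * z t @[t --> F] --> k.
  rewrite (_ : (fun t => _) = cst k); first exact: cvg_cst.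
  by apply/funext => t; exact: Wk.
have W0_cvg : y t * derive1 z t - derive1 y t * z t @[t --> F] --> (0 : R).
  rewrite -[X in _ --> X](subr0 0).
  by apply: (cvgB (b0 _ _ yb z'0) (b0 _ _ y'b z0)).
have k0 : k = 0 by apply: (cvg_unique (@Rhausdorff R) Wk_cvg W0_cvg).
by apply/eqP; rewrite -subr_eq0 Wk k0.
Qed.

End RealSolutions.

(** * Solutions built from the factorization, and uniqueness *)

Section MiuraSolutions.
Context {R : realType}.
Notation mu := (@lebesgue_measure R).
Context (w : R -> R) (hw : schwartz w).
Implicit Types (al be u : R -> R) (a b k x : R).

Let q := miura w.
Let cw := schwartz_continuous w hw.
Let iw := schwartz_integrable w hw.

(** Eliminating the second component of the first order system is the Miura
    factorization [- d^2 - q = (- d + w) (d + w)] at energy [k ^ 2]. *)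
Lemma wave_solution k al be :
  zs_solution w k al be -> real_solution q (k ^+ 2) (wave k al be).
Proof.
move=> zs; have dy := is_derive_wave zs; have dv := is_derive_wave_conj zs.
apply: (real_solutionI _ _ _ (fun x => - w x * wave k al be x +
  k * wave_conj k al be x)) => // x.
apply: is_derive_eq (is_derive_fun_add
  (is_derive_fun_mul (is_derive_fun_opp (schwartz_is_derive w hw x)) (dy x))
  (is_derive_fun_scale k (dv x))) _.
by rewrite /q /miura; ring.
Qed.

Lemma derive1_wave k al be x : zs_solution w k al be ->
  derive1 (wave k al be) x =
  - w x * wave k al be x + k * wave_conj k al be x.
Proof. by move=> zs; rewrite (is_derive_derive1 (is_derive_wave zs)). Qed.

Lemma wave_det k al1 be1 al2 be2 x :
  wave k al1 be1 x * wave_conj k al2 be2 x -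
  wave k al2 be2 x * wave_conj k al1 be1 x =
  al1 x * be2 x - al2 x * be1 x.
Proof.
have := cos2Dsin2 (k * x); rewrite /wave /wave_conj => h.
transitivity ((cos (k * x) ^+ 2 + sin (k * x) ^+ 2) *
  (al1 x * be2 x - al2 x * be1 x)); first by ring.
by rewrite h mul1r.
Qed.

Lemma wave_le k al be c x : (forall x, `|al x| <= c) -> (forall x, `|be x| <= c) ->
  `|wave k al be x| <= 2 * c /\ `|wave_conj k al be x| <= 2 * c.
Proof.
move=> ac bc.
have h (s t : R) : `|s| <= 1 -> `|t| <= c -> `|s * t| <= c.
  by move=> s1 tc; rewrite normrM -[c]mul1r ler_pM.
have -> : 2 * c = c + c by ring.
by split; [apply: (le_trans (ler_normD _ _))|apply: (le_trans (ler_normB _ _))];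
  apply: lerD; apply: h; rewrite ?cos_max ?sin_max.
Qed.

Lemma wave_asymptotic (F : set_system R) {FF : Filter F} k al be a b :
  al x @[x --> F] --> a -> be x @[x --> F] --> b ->
  wave k al be x - (cos (k * x) * a + sin (k * x) * b) @[x --> F] --> (0 : R).
Proof.
move=> ala beb.
have z (f : R -> R) l : f x @[x --> F] --> l -> f x - l @[x --> F] --> (0 : R).
  by move=> fl; rewrite -(subrr l); apply: cvgB => //; exact: cvg_cst.
have h1 : cos (k * x) * (al x - a) @[x --> F] --> (0 : R).
  exact: (cvg0_bounded_mul F _ _ 1 (fun x => cos_max (k * x)) (z _ _ ala)).
have h2 : sin (k * x) * (be x - b) @[x --> F] --> (0 : R).
  exact: (cvg0_bounded_mul F _ _ 1 (fun x => sin_max (k * x)) (z _ _ beb)).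
rewrite (_ : (fun x => _) = (fun x => cos (k * x) * (al x - a) +
    sin (k * x) * (be x - b))); last by apply/funext => x; rewrite /wave; ring.
by rewrite -[X in _ --> X](addr0 0); apply: (cvgD h1 h2).
Qed.

(** [exp (- \int w)] is annihilated by [d + w]: the zero energy solution. *)
Definition ground_state x := expR (- primitive w x).

Lemma is_derive_ground_state x :
  is_derive x 1 ground_state (- w x * ground_state x).
Proof.
have dW : is_derive x 1 (primitive w) (w x) by exact: is_derive_primitive.
apply: is_derive_eq (is_derive_fun_expR (is_derive_fun_opp dW)) _.
by rewrite mulrC.
Qed.

Lemma ground_state_solution : real_solution q 0 ground_state.
Proof.
apply: (real_solutionI _ _ _ (fun x => - w x * ground_state x)).
  exact: is_derive_ground_state.
move=> x; apply: is_derive_eq (is_derive_fun_mul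
  (is_derive_fun_opp (schwartz_is_derive w hw x)) (is_derive_ground_state x)) _.
by rewrite /q /miura; ring.
Qed.

Lemma ground_state_le x : ground_state x <= expR (\int[mu]_x `|w x|).
Proof.
rewrite ler_expR (le_trans (ler_norm _))// normrN.
exact: normr_primitive_le.
Qed.

(** Zero Wronskian with [ground_state] means [u' + w u = 0], so [u exp (\int w)] is
    constant; its limit along [F] is zero. *)
Lemma vanishing_solution0 (F : set_system R) {FF : ProperFilter F} u :
  unit_stable F -> real_solution q 0 u -> u x @[x --> F] --> (0 : R) ->
  forall x, u x = 0.
Proof.
move=> stF us u0.
have [Q qQ] := miura_bounded w hw; have [B wB] := schwartz_bounded w hw.
pose K := expR (\int[mu]_x `|w x|).
have gK x : `|ground_state x| <= K.
  by rewrite ger0_norm ?expR_ge0//; exact: ground_state_le.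
have dg x : derive1 ground_state x = - w x * ground_state x.
  by rewrite (is_derive_derive1 is_derive_ground_state).
have W0 := wronskian_eq0 F q 0 ground_state u Q stF qQ ground_state_solution us.
have {}W0 x : derive1 u x = - w x * u x.
  have g0 : ground_state x != 0 by rewrite gt_eqF// expR_gt0.
  apply: (mulfI g0); rewrite W0 ?dg//; first by ring.
    by exists K.
  exists (B * K) => t; rewrite dg normrM normrN ler_pM//.
have [u1 _] := real_solution_derive us.
have iW x : `|expR (primitive w x)| <= K.
  rewrite ger0_norm ?expR_ge0// ler_expR (le_trans (ler_norm _))//.
  exact: normr_primitive_le.
have c0 : expR (primitive w x) * u x @[x --> F] --> (0 : R).
  exact: (cvg0_bounded_mul _ _ _ K).
have dE x : is_derive x 1 (fun x => expR (primitive w x) * u x) 0.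
  have dW : is_derive x 1 (primitive w) (w x) by exact: is_derive_primitive.
  apply: is_derive_eq (is_derive_fun_mul (is_derive_fun_expR dW) (u1 x)) _.
  by rewrite W0; ring.
move=> x; have E t : expR (primitive w t) * u t = expR (primitive w x) * u x.
  exact: (is_derive_0_is_cst (f := fun x => expR (primitive w x) * u x)).
have cx : expR (primitive w t) * u t @[t --> F] --> expR (primitive w x) * u x.
  rewrite (_ : (fun t => _) = cst (expR (primitive w x) * u x)).
    exact: cvg_cst.
  by apply/funext => t; exact: E.
have /eqP : expR (primitive w x) * u x = 0.
  by apply: (cvg_unique (@Rhausdorff R) cx c0).
by rewrite mulf_eq0 gt_eqF ?expR_gt0//= => /eqP.
Qed.

(** For [k <> 0] two bounded solutions span the solution space, and a solution
    vanishing at one end has zero Wronskian with both of them. *)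
Lemma vanishing_solution (F : set_system R) {FF : ProperFilter F} k u :
  unit_stable F -> real_solution q (k ^+ 2) u -> u x @[x --> F] --> (0 : R) ->
  forall x, u x = 0.
Proof.
move=> stF; have [->|k0] := eqVneq k 0.
  by rewrite expr0n; exact: vanishing_solution0.
move=> us u0.
have [Q qQ] := miura_bounded w hw; have [B wB] := schwartz_bounded w hw.
have W a b : exists al be a' b', zs_connects w k al be a b a' b' /\
    forall x, wave_conj k al be x * u x = wave k al be x * ((derive1 u x + w x * u x) / k).
  have [al [be [a' [b' [co [ac bc]]]]]] := zs_solution_exists w cw iw k a b.
  exists al, be, a', b'; split=> // x; have [zs _ _ _ _] := co.
  have W0 : wave k al be x * derive1 u x = derive1 (wave k al be) x * u x.
    apply: (wronskian_eq0 F q (k ^+ 2) _ u Q stF qQ (wave_solution _ _ _ zs) us) => //.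
      by exists (2 * ((`|a| + `|b|) * expR (4 * \int[mu]_x `|w x|))) => t;
        exact: (wave_le k _ _ _ t ac bc).1.
    exists (B * (2 * ((`|a| + `|b|) * expR (4 * \int[mu]_x `|w x|))) +
      `|k| * (2 * ((`|a| + `|b|) * expR (4 * \int[mu]_x `|w x|)))) => t.
    have [h1 h2] := wave_le k _ _ _ t ac bc.
    rewrite derive1_wave//; apply: (le_trans (ler_normD _ _)).
    by apply: lerD; rewrite normrM ?normrN ler_pM.
  rewrite derive1_wave// in W0.
  rewrite mulrA mulrDr W0; apply: (mulIf k0); rewrite divfK//; ring.
have [al1 [be1 [a1 [b1 [co1 E1]]]]] := W 1 0.
have [al2 [be2 [a2 [b2 [co2 E2]]]]] := W 0 1.
have [det _] := zs_det w co1 co2.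
move=> x; have := wave_det k al1 be1 al2 be2 x.
rewrite det mulr1 mul0r subr0 => d1.
by rewrite -[u x]mul1r -d1 mulrBl -!mulrA E1 E2; ring.
Qed.

(** Differentiating a linear relation gives the same relation between the
    [wave_conj], because [k <> 0]; the conserved determinant is [1]. *)
Lemma wave_independent k al1 be1 al2 be2 a1' b1' a2' b2' (r s : R) : k != 0 ->
  zs_connects w k al1 be1 1 0 a1' b1' -> zs_connects w k al2 be2 0 1 a2' b2' ->
  (forall x, r * wave k al1 be1 x + s * wave k al2 be2 x = 0) -> r = 0 /\ s = 0.
Proof.
move=> k0 co1 co2 E.
have [det _] := zs_det w co1 co2.
have := wave_det k al1 be1 al2 be2 0; rewrite det mulr1 mul0r subr0 => d1.
have [[zs1 _ _ _ _] [zs2 _ _ _ _]] := (co1, co2).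
have dE : is_derive (0 : R) 1
    (fun x => r * wave k al1 be1 x + s * wave k al2 be2 x) 0.
  rewrite (_ : (fun x => _) = cst 0); first exact: is_derive_cst.
  by apply/funext => x; exact: E.
have dE' := is_derive_fun_add (is_derive_fun_scale r (is_derive_wave zs1 0))
  (is_derive_fun_scale s (is_derive_wave zs2 0)).
have := etrans (esym (@derive_val _ _ _ _ _ _ _ dE))
  (@derive_val _ _ _ _ _ _ _ dE').
have := E 0; move: d1.
set y1 := wave k al1 be1 0; set v1 := wave_conj k al1 be1 0.
set y2 := wave k al2 be2 0; set v2 := wave_conj k al2 be2 0.
move=> d1 e1 /esym e2.
have e3 : r * v1 + s * v2 = 0.
  apply: (mulfI k0); rewrite mulr0.
  transitivity (r * (- w 0 * y1 + k * v1) + s * (- w 0 * y2 + k * v2) +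
    w 0 * (r * y1 + s * y2)); first by ring.
  by rewrite e1 e2 mulr0 addr0.
split.
  rewrite -[r]mulr1 -d1.
  transitivity (v2 * (r * y1 + s * y2) - y2 * (r * v1 + s * v2)); first by ring.
  by rewrite e1 e3; ring.
rewrite -[s]mulr1 -d1.
transitivity (y1 * (r * v1 + s * v2) - v1 * (r * y1 + s * y2)); first by ring.
by rewrite e1 e3; ring.
Qed.

End MiuraSolutions.

(** * Jost solutions at real momentum *)

Section ComplexLimits.
Context {R : realType}.
Implicit Types (F : set_system R) (f : R -> R[i]) (z l : R[i]).

Lemma normc_le_ReIm z : `|z| <= (`|complex.Re z| + `|complex.Im z|)%:C.
Proof.
rewrite normc_def lecR -[leRHS]ger0_norm ?addr_ge0// -sqrtr_sqr.
apply: ler_wsqrtr; rewrite sqrrD !real_normK ?num_real//.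
by rewrite -addrA [_ *+ 2 + _]addrC addrA lerDl mulrn_wge0// mulr_ge0.
Qed.

Lemma normc_ge_Im z : `|complex.Im z|%:C <= `|z|.
Proof.
rewrite normc_def lecR -sqrtr_sqr; apply: ler_wsqrtr.
by rewrite lerDr sqr_ge0.
Qed.

Lemma cvg_complexP F {FF : Filter F} f l :
  ((f x : R[i]^o) @[x --> F] --> (l : R[i]^o)) <->
  (complex.Re (f x) @[x --> F] --> complex.Re l /\
   complex.Im (f x) @[x --> F] --> complex.Im l).
Proof.
split=> [/cvgrPdist_lt fl|[/cvgrPdist_lt rl /cvgrPdist_lt il]].
  split; apply/cvgrPdist_lt => e e0.
    have /fl : (0 : R[i]) < e%:C by rewrite ltcR.
    apply: filterS => x h; rewrite -ltcR; apply: le_lt_trans h.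
    by rewrite -raddfB; exact: normc_ge_Re.
  have /fl : (0 : R[i]) < e%:C by rewrite ltcR.
  apply: filterS => x h; rewrite -ltcR; apply: le_lt_trans h.
  by rewrite -raddfB; exact: normc_ge_Im.
apply/cvgrPdist_lt => -[e i]; rewrite ltcE/= => /andP[/eqP -> e0].
have e2 : 0 < e / 2 by rewrite divr_gt0.
apply: filterS2 (rl _ e2) (il _ e2) => x h1 h2.
apply: (le_lt_trans (normc_le_ReIm _)); rewrite complexr0 ltcR !raddfB/=.
by rewrite [ltRHS]splitr ltrD.
Qed.

(** Division by [exp (i theta)] is a rotation, which neither creates nor
    destroys convergence to zero. *)
Lemma cvg_div_unitP F {FF : Filter F} f (theta : R -> R) :
  ((f x / (cos (theta x) +i* sin (theta x)) : R[i]^o) @[x --> F] -->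
     (1 : R[i]^o)) <->
  (complex.Re (f x) - cos (theta x) @[x --> F] --> (0 : R) /\
   complex.Im (f x) - sin (theta x) @[x --> F] --> (0 : R)).
Proof.
pose c x := cos (theta x); pose s x := sin (theta x).
have c1 x : `|c x| <= 1 by exact: cos_max.
have s1 x : `|s x| <= 1 by exact: sin_max.
have cs x : c x ^+ 2 + s x ^+ 2 = 1 by exact: cos2Dsin2.
have cs_neq0 x : c x +i* s x != 0.
  rewrite eq_complex /=; apply/negP => /andP[/eqP c0 /eqP s0].
  have := cs x; rewrite c0 s0 !expr0n addr0 => /eqP.
  by rewrite eq_sym oner_eq0.
have divE x : f x / (c x +i* s x) =
    (complex.Re (f x) * c x + complex.Im (f x) * s x) +i*
    (complex.Im (f x) * c x - complex.Re (f x) * s x).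
  apply: (mulIf (cs_neq0 x)); rewrite divfK//; case: (f x) => a b.
  apply/eqP; rewrite eq_complex /=; apply/andP; split; apply/eqP.
    by rewrite -[LHS]mulr1 -(cs x); ring.
  by rewrite -[LHS]mulr1 -(cs x); ring.
have mul0 (u v : R -> R) : (forall x, `|u x| <= 1) -> v x @[x --> F] --> (0 : R) ->
    u x * v x @[x --> F] --> (0 : R).
  by move=> u1; exact: cvg0_bounded_mul u1.
have add0 (u v : R -> R) : u x @[x --> F] --> (0 : R) ->
    v x @[x --> F] --> (0 : R) -> u x + v x @[x --> F] --> (0 : R).
  by move=> u0 v0; rewrite -[X in _ --> X](addr0 0); apply: (cvgD u0 v0).
have sub0 (u v : R -> R) : u x @[x --> F] --> (0 : R) ->
    v x @[x --> F] --> (0 : R) -> u x - v x @[x --> F] --> (0 : R).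
  by move=> u0 v0; rewrite -[X in _ --> X](subr0 0); apply: (cvgB u0 v0).
rewrite cvg_complexP.
rewrite (_ : (fun x => complex.Re _) =
  (fun x => complex.Re (f x) * c x + complex.Im (f x) * s x)); last first.
  by apply/funext => x; rewrite divE.
rewrite (_ : (fun x => complex.Im (_ / _)) =
  (fun x => complex.Im (f x) * c x - complex.Re (f x) * s x)); last first.
  by apply/funext => x; rewrite divE.
split=> [[rl il]|[rl il]].
- have {}rl : complex.Re (f x) * c x + complex.Im (f x) * s x - 1 @[x --> F] --> (0 : R).
    exact/subr_cvg0.
  split.
    rewrite (_ : (fun x => _) = (fun x =>
      c x * (complex.Re (f x) * c x + complex.Im (f x) * s x - 1) -
      s x * (complex.Im (f x) * c x - complex.Re (f x) * s x))).
      exact: sub0 (mul0 _ _ c1 rl) (mul0 _ _ s1 il).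
    apply/funext => x; transitivity (complex.Re (f x) * (c x ^+ 2 + s x ^+ 2) - c x).
      by rewrite cs mulr1.
    by ring.
  rewrite (_ : (fun x => _) = (fun x =>
    s x * (complex.Re (f x) * c x + complex.Im (f x) * s x - 1) +
    c x * (complex.Im (f x) * c x - complex.Re (f x) * s x))).
    exact: add0 (mul0 _ _ s1 rl) (mul0 _ _ c1 il).
  apply/funext => x; transitivity (complex.Im (f x) * (c x ^+ 2 + s x ^+ 2) - s x).
    by rewrite cs mulr1.
  by ring.
- split.
    apply/subr_cvg0; rewrite (_ : (fun x => _) = (fun x =>
      c x * (complex.Re (f x) - c x) + s x * (complex.Im (f x) - s x))).
      exact: add0 (mul0 _ _ c1 rl) (mul0 _ _ s1 il).
    by apply/funext => x; rewrite /= -(cs x); ring.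
  rewrite (_ : (fun x => _) = (fun x =>
    c x * (complex.Im (f x) - s x) - s x * (complex.Re (f x) - c x))).
    exact: sub0 (mul0 _ _ c1 il) (mul0 _ _ s1 rl).
  by apply/funext => x; ring.
Qed.

End ComplexLimits.

Section JostSolutions.
Context {R : realType}.
Implicit Types (F : set_system R) (q : R -> R) (y : R -> R[i]) (k x : R).

Lemma cexp_imaginary (t : R) : cexp (0 +i* t) = cos t +i* sin t.
Proof.
rewrite /cexp /= expR0; apply/eqP.
by rewrite eq_complex /=; apply/andP; split; apply/eqP; ring.
Qed.

Lemma energy_solutionP q k y : energy_solution q k%:C y <->
  real_solution q (k ^+ 2) (reP y) /\ real_solution q (k ^+ 2) (imP y).
Proof.
have E x : (- cderive (cderive y) x - (q x)%:C * y x = k%:C ^+ 2 * y x) <->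
    (- derive1 (derive1 (reP y)) x - q x * reP y x = k ^+ 2 * reP y x /\
     - derive1 (derive1 (imP y)) x - q x * imP y x = k ^+ 2 * imP y x).
  have -> : cderive (cderive y) x =
    derive1 (derive1 (reP y)) x +i* derive1 (derive1 (imP y)) x by [].
  move: (derive1 (derive1 (reP y)) x) (derive1 (derive1 (imP y)) x) => a b.
  rewrite -rmorphXn /reP /imP; case: (y x) => u v.
  split=> [/eqP|[/= e1 e2]]; last apply/eqP; rewrite eq_complex /=.
    by move=> /andP[/eqP h1 /eqP h2]; split; lra.
  by apply/andP; split; apply/eqP; lra.
split=> [ys|[rs is_] x].
  split=> x; have [[d1 d2] [d3 d4] /E[e1 e2]] := ys x; split.
  - exact: d1.
  - exact: d3.
  - exact: e1.
  - exact: d2.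
  - exact: d4.
  - exact: e2.
have [d1 d3 e1] := rs x; have [d2 d4 e2] := is_ x.
split; [split; [exact: d1|exact: d2]|split; [exact: d3|exact: d4]|].
by apply/E; split; [exact: e1|exact: e2].
Qed.

(** A Jost solution at real momentum, split into real solutions whose
    asymptotics are [cos (kx)] and [sin (kx)]. *)
Definition real_jost F q k y :=
  [/\ real_solution q (k ^+ 2) (reP y), real_solution q (k ^+ 2) (imP y),
      reP y x - cos (k * x) @[x --> F] --> (0 : R) &
      imP y x - sin (k * x) @[x --> F] --> (0 : R)].

Lemma is_jost_plusP q k y : is_jost_plus q k%:C y <-> real_jost +oo q k y.
Proof.
rewrite /is_jost_plus.
have -> : (fun x => y x / cexp ('i%C * k%:C * x%:C)) =
    (fun x => y x / (cos (k * x) +i* sin (k * x))).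
  apply/funext => x; rewrite -cexp_imaginary; congr (_ / cexp _).
  by apply/eqP; rewrite eq_complex /=; apply/andP; split; apply/eqP; ring.
by rewrite energy_solutionP cvg_div_unitP; split=> [[[? ?] [? ?]]|[]].
Qed.

Lemma is_jost_minusP q k y : is_jost_minus q k%:C y <-> real_jost -oo q (- k) y.
Proof.
rewrite /is_jost_minus.
have -> : (fun x => y x / cexp (- ('i%C * k%:C * x%:C))) =
    (fun x => y x / (cos (- k * x) +i* sin (- k * x))).
  apply/funext => x; rewrite -cexp_imaginary; congr (_ / cexp _).
  by apply/eqP; rewrite eq_complex /=; apply/andP; split; apply/eqP; ring.
rewrite /real_jost sqrrN energy_solutionP cvg_div_unitP.
by split=> [[[? ?] [? ?]]|[]].
Qed.

(** The difference of two Jost solutions is a solution vanishing along [F]. *)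
Lemma real_jost_unique F {FF : ProperFilter F} w k y z : schwartz w ->
  unit_stable F -> real_jost F (miura w) k y -> real_jost F (miura w) k z ->
  y = z.
Proof.
move=> hw stF [ry iy ly my] [rz iz lz mz].
have sub (f g h : R -> R) : f x - h x @[x --> F] --> (0 : R) ->
    g x - h x @[x --> F] --> (0 : R) -> 
    1 * f x + (-1) * g x @[x --> F] --> (0 : R).
  move=> fh gh; rewrite -[X in _ --> X](subr0 0).
  rewrite (_ : (fun x => _) = (fun x => (f x - h x) - (g x - h x))).
    by apply: (cvgB fh gh).
  by apply/funext => x; ring.
have r0 t : 1 * reP y t + (-1) * reP z t = 0.
  exact: (vanishing_solution w hw F k _ stF (real_solution_lin 1 (-1) ry rz)
    (sub _ _ _ ly lz)).
have i0 t : 1 * imP y t + (-1) * imP z t = 0.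
  exact: (vanishing_solution w hw F k _ stF (real_solution_lin 1 (-1) iy iz)
    (sub _ _ _ my mz)).
apply/funext => x; apply/eqP; rewrite eq_complex.
have := r0 x; have := i0 x; rewrite /reP /imP => e1 e2.
by apply/andP; split; apply/eqP; lra.
Qed.

Lemma jost_plusE w k y : schwartz w -> real_jost +oo (miura w) k y ->
  jost_plus (miura w) k%:C = y.
Proof.
move=> hw yj; apply: xget_unique; first exact/is_jost_plusP.
move=> z /is_jost_plusP zj.
exact: (real_jost_unique +oo w k z y hw unit_stable_pinfty).
Qed.

Lemma jost_minusE w k y : schwartz w -> real_jost -oo (miura w) (- k) y ->
  jost_minus (miura w) k%:C = y.
Proof.
move=> hw yj; apply: xget_unique; first exact/is_jost_minusP.
move=> z /is_jost_minusP zj.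
exact: (real_jost_unique -oo w (- k) z y hw unit_stable_ninfty).
Qed.

End JostSolutions.

(** * Product rule for absolutely continuous functions *)

Section AbsolutelyContinuous.
Context {R : realType}.
Notation mu := (@lebesgue_measure R).
Implicit Types (f g h : R -> R) (a b x y : R).

Definition real_ac f f1 := forall x y, x <= y ->
  mu.-integrable `[x, y] (EFin \o f1) /\
  f y - f x = \int[mu]_(t in `[x, y]) f1 t.

Lemma integral_EFin (A : set R) h : measurable A ->
  mu.-integrable A (EFin \o h) ->
  (\int[mu]_(x in A) (h x)%:E)%E = (\int[mu]_(x in A) h x)%:E.
Proof. by move=> mA ih; rewrite /Rintegral fineK// integrable_fin_num. Qed.

Lemma real_ac_within f f1 a b : real_ac f f1 -> a <= b ->
  {within `[a, b], continuous f}.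
Proof.
move=> ff1 ab; have [if1 _] := ff1 _ _ ab.
have cF := parameterized_integral_continuous ab if1.
apply: (@subspace_eq_continuous _ _ _
  (fun x => f a + parameterized_integral mu a x f1)).
  move=> x; rewrite inE /= in_itv/= => /andP[ax _].
  by rewrite /parameterized_integral -(ff1 _ _ ax).2 addrC subrK.
by move=> x; apply: cvgD; [exact: cvg_cst|exact: cF].
Qed.

Lemma real_ac_integrableM f f1 g g1 a b : real_ac f f1 -> real_ac g g1 ->
  a <= b -> mu.-integrable `[a, b] (EFin \o (fun x => f1 x * g x)).
Proof.
move=> ff1 gg1 ab; have [if1 _] := ff1 _ _ ab.
have cg := real_ac_within _ _ _ _ gg1 ab.
apply: (integrableMl _ if1) => //.
  exact: subspace_continuous_measurable_fun.
have /compact_bounded[N [Nr gN]] := continuous_compact cg (@segment_compact R a b).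
by exists N; split=> // z Nz t abt; apply: gN => //; exists t.
Qed.

Lemma measurable_patch0 (A : set R) h : measurable A ->
  mu.-integrable A (EFin \o h) -> measurable_fun setT (h \_ A).
Proof.
move=> mA /measurable_int/measurable_EFinP mh.
by apply/(measurable_restrictT _ _).1.
Qed.

(** The inner integrals over the triangle [a <= s <= t <= b]; extending the
    densities by zero lets both range over the whole line. *)
Lemma triangle_integral_fst f1 g1 g a b s : real_ac g g1 ->
  (\int[mu]_t ((f1 \_ `[a, b]) s * (g1 \_ `[a, b]) t * (s <= t)%R%:R)%:E =
   (((fun s => f1 s * (g b - g s)) \_ `[a, b]) s)%:E)%E.
Proof.
move=> gg1; rewrite [X in (X)%:E]patchE; case: ifPn => sab; last first.
  under eq_integral => t _.
    rewrite [(f1 \_ _) _]patchE (negbTE sab) !mul0r.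
    over.
  by rewrite integral0.
have : a <= s <= b by move: sab; rewrite inE /= in_itv.
case/andP => as_ sb; have [ig1 gE] := gg1 _ _ sb.
rewrite gE EFinM -integral_EFin// -integralZl//.
rewrite [RHS]integral_mkcond; apply: eq_integral => t _.
rewrite [(f1 \_ _) _]patchE sab !patchE !mem_setE !in_itv/=.
have [st|ts] := leP s t; last by rewrite mulr0.
by rewrite (le_trans as_ st)/= mulr1; case: ifP => // _; rewrite mulr0.
Qed.

Lemma triangle_integral_snd f f1 g1 a b t : real_ac f f1 ->
  (\int[mu]_s ((f1 \_ `[a, b]) s * (g1 \_ `[a, b]) t * (s <= t)%R%:R)%:E =
   (((fun t => g1 t * (f t - f a)) \_ `[a, b]) t)%:E)%E.
Proof.
move=> ff1; rewrite [X in (X)%:E]patchE; case: ifPn => tab; last first.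
  under eq_integral => s _.
    rewrite [(g1 \_ _) _]patchE (negbTE tab) mulr0 mul0r.
    over.
  by rewrite integral0.
have : a <= t <= b by move: tab; rewrite inE /= in_itv.
case/andP => at_ tb; have [if1 fE] := ff1 _ _ at_.
rewrite fE EFinM -integral_EFin// -integralZl//.
rewrite [RHS]integral_mkcond; apply: eq_integral => s _.
rewrite [(g1 \_ _) _]patchE tab !patchE !mem_setE !in_itv/=.
have [st|ts] := leP s t; last by rewrite mulr0 andbF.
rewrite (le_trans st tb) !andbT mulr1; case: ifP => // _; first by rewrite mulrC.
by rewrite mul0r.
Qed.

Lemma integrable_tensor p r : mu.-integrable setT (EFin \o p) ->
  mu.-integrable setT (EFin \o r) ->
  (mu \x mu)%E.-integrable setT (EFin \o (fun z : R * R => p z.1 * r z.2)).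
Proof.
move=> /integrableP[mp ip] /integrableP[mr ir].
have mp' : measurable_fun setT p by exact/measurable_EFinP.
have mr' : measurable_fun setT r by exact/measurable_EFinP.
apply/integrable12ltyP.
  apply/measurable_EFinP; apply: measurable_funM; exact: measurableT_comp.
under eq_integral => s _.
  under eq_integral => t _ do rewrite /= normrM EFinM.
  rewrite ge0_integralZl//; last first.
    by apply/measurable_EFinP; exact: measurableT_comp.
  over.
rewrite ge0_integralZr//.
- by apply: lte_mul_pinfty; rewrite ?integral_ge0 ?ge0_fin_numE ?integral_ge0.
- by apply/measurable_EFinP; exact: measurableT_comp.
- exact: integral_ge0.
Qed.

(** Both sides are the integral of [f1 s * g1 t] over the triangle
    [a <= s <= t <= b]. *)
Lemma real_ac_fubini f f1 g g1 a b : real_ac f f1 -> real_ac g g1 -> a <= b ->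
  \int[mu]_(s in `[a, b]) (f1 s * (g b - g s)) =
  \int[mu]_(t in `[a, b]) (g1 t * (f t - f a)).
Proof.
move=> ff1 gg1 ab; have [if1 _] := ff1 _ _ ab; have [ig1 _] := gg1 _ _ ab.
pose p := f1 \_ `[a, b]; pose r := g1 \_ `[a, b].
have mp : measurable_fun setT p by exact: measurable_patch0.
have mr : measurable_fun setT r by exact: measurable_patch0.
have ip : mu.-integrable setT (EFin \o p).
  by rewrite -restrict_EFin; apply/(integrable_mkcond _ _).1.
have ir : mu.-integrable setT (EFin \o r).
  by rewrite -restrict_EFin; apply/(integrable_mkcond _ _).1.
pose H (z : R * R) := (p z.1 * r z.2 * (z.1 <= z.2)%R%:R)%:E.
have mH : measurable_fun setT H.
  apply/measurable_EFinP; apply: measurable_funM; first apply: measurable_funM.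
  - exact: measurableT_comp.
  - exact: measurableT_comp.
  - rewrite (_ : (fun z => _) = (fun z : R * R => if z.1 <= z.2 then 1 else 0)).
      by apply: measurable_fun_ifT => //; exact: measurable_fun_ler.
    by apply/funext => z; case: ifP.
have iH : (mu \x mu)%E.-integrable setT H.
  apply: (le_integrable _ _ _ (integrable_tensor p r ip ir)) => //.
  move=> z _ /=; rewrite lee_fin normrM ler_piMr//.
  by case: (z.1 <= z.2); rewrite ?normr1 ?normr0.
have := Fubini iH.
rewrite /H /=.
under eq_integral => s _ do rewrite (triangle_integral_fst _ _ g)//.
under [X in _ = X -> _]eq_integral => t _ do rewrite (triangle_integral_snd f)//.
move=> e; rewrite Rintegral_mkcond [RHS]Rintegral_mkcond /Rintegral.
by rewrite e.
Qed.

Lemma real_acM f f1 g g1 : real_ac f f1 -> real_ac g g1 ->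
  real_ac (fun x => f x * g x) (fun x => f1 x * g x + f x * g1 x).
Proof.
move=> ff1 gg1 a b ab.
have [if1 f1E] := ff1 _ _ ab; have [ig1 g1E] := gg1 _ _ ab.
have i1 := real_ac_integrableM _ _ _ _ _ _ ff1 gg1 ab.
have i2 : mu.-integrable `[a, b] (EFin \o (fun x => f x * g1 x)).
  have := real_ac_integrableM _ _ _ _ _ _ gg1 ff1 ab.
  by apply: eq_integrable => // x _ /=; rewrite mulrC.
split; first by have := integrableD _ i1 i2; exact.
rewrite RintegralD//.
have := real_ac_fubini _ _ _ _ _ _ ff1 gg1 ab.
rewrite [in LHS](_ : (fun s => _) = (fun s => f1 s * g b - f1 s * g s)); last first.
  by apply/funext => s; rewrite mulrBr.
rewrite [in RHS](_ : (fun t => _) = (fun t => f t * g1 t - g1 t * f a)); last first.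
  by apply/funext => t; rewrite mulrBr mulrC.
rewrite RintegralB//; last exact: (integrableZr _ _ if1).
rewrite RintegralB//; last exact: (integrableZr _ _ ig1).
rewrite !RintegralZr// -f1E -g1E; lra.
Qed.

End AbsolutelyContinuous.

(** * Nonnegativity of the operator *)

Section Nonnegativity.
Context {R : realType}.
Notation mu := (@lebesgue_measure R).
Implicit Types (f g h u v G : R -> R) (a b c l x y : R).

Local Notation integrableT f := (mu.-integrable setT (EFin \o f)).

Lemma integrable_fun_add f g : integrableT f -> integrableT g ->
  integrableT (fun x => f x + g x).
Proof. by move=> fi gi; have := integrableD measurableT fi gi; exact. Qed.

Lemma integrable_fun_sub f g : integrableT f -> integrableT g ->
  integrableT (fun x => f x - g x).
Proof. by move=> fi gi; have := integrableB measurableT fi gi; exact. Qed.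

Lemma integrable_bounded_mul f g c : continuous f -> (forall x, `|f x| <= c) ->
  integrableT g -> integrableT (fun x => f x * g x).
Proof.
move=> cf fc gi; have c0 : 0 <= c := le_trans (normr_ge0 _) (fc 0).
apply: (le_integrable _ _ _ (integrableZl measurableT c gi)) => //.
  apply/measurable_EFinP; apply: measurable_funM.
    exact: continuous_measurable_fun.
  by have /measurable_int/measurable_EFinP := gi.
by move=> x _ /=; rewrite lee_fin !normrM ler_wpM2r// (ger0_norm c0).
Qed.

Lemma Lfun2_integrableM f g : f \in Lfun mu 2%:E -> g \in Lfun mu 2%:E ->
  integrableT (fun x => f x * g x).
Proof. by move=> f2 g2; apply/Lfun1_integrable; exact: Lfun2_mul_Lfun1. Qed.

Lemma real_acD f f1 g g1 : real_ac f f1 -> real_ac g g1 ->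
  real_ac (fun x => f x + g x) (fun x => f1 x + g1 x).
Proof.
move=> ff1 gg1 x y xy; have [if1 fE] := ff1 _ _ xy; have [ig1 gE] := gg1 _ _ xy.
split; first by have := integrableD _ if1 ig1; exact.
by rewrite RintegralD// -fE -gE; ring.
Qed.

Lemma real_ac_smooth f f1 : (forall x, is_derive x 1 f (f1 x)) ->
  continuous f1 -> real_ac f f1.
Proof.
move=> fE cf1 x y xy.
have cw a b : {within `[a, b], continuous f1} by exact: continuous_subspaceT.
have if1 : mu.-integrable `[x, y] (EFin \o f1).
  by apply: continuous_compact_integrable => //; exact: segment_compact.
split=> //; move: xy if1; rewrite le_eqVlt => /predU1P[<- _|xy if1].
  by rewrite set_itv1 subrr Rintegral_set1.
have cf := is_derive_continuous fE.
have := continuous_FTC2 xy (cw _ _).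
rewrite integral_EFin// => /(_ f).
move=> h; apply/esym; apply: EFin_inj; rewrite h//.
  split.
  - by move=> t _; case: (fE t).
  - by apply: cvg_at_right_filter; exact: cf.
  - by apply: cvg_at_left_filter; exact: cf.
by move=> t _; rewrite (is_derive_derive1 fE).
Qed.

Lemma integrable_not_bounded_below f c : integrableT f -> 0 < c ->
  (forall d, 0 <= d -> exists a, forall t, a <= t <= a + d -> c <= `|f t|) ->
  False.
Proof.
move=> fi c0 far; pose J := \int[mu]_t `|f t|.
have fni : integrableT (fun t => `|f t|) by exact: integrable_norm fi.
have J0 : 0 <= J by apply: Rintegral_ge0.
(* on a segment of this length the lower bound exceeds the total integral *)
have d0 : 0 <= J / c + 1 by rewrite addr_ge0// divr_ge0// ltW.
have [a aP] := far _ d0.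
have fniI : mu.-integrable `[a, a + (J / c + 1)] (EFin \o (fun t => `|f t|)).
  exact: integrableS fni.
have : \int[mu]_(t in `[a, a + (J / c + 1)]) c <= J.
  apply: (@le_trans _ _ (\int[mu]_(t in `[a, a + (J / c + 1)]) `|f t|)).
    apply: le_Rintegral => //.
    apply: (@continuous_compact_integrable _ (cst c)).
      exact: segment_compact.
    by move=> ?; exact: cvg_cst.
  rewrite Rintegral_mkcond; apply: le_Rintegral => //.
    by rewrite -restrict_EFin; apply/(integrable_mkcond _ _).1.
  by move=> t _; rewrite patchE; case: ifP => // _; exact: normr_ge0.
rewrite Rintegral_cst//= lebesgue_measure_itv/= lte_fin ltrDl.
rewrite (_ : 0 < J / c + 1)/=; last by rewrite ltr_wpDl// divr_ge0// ltW.
rewrite (addrC a) addrK mulrDr mulr1 mulrCA divff ?gt_eqF// mulr1.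
by lra.
Qed.

Lemma integrable_cvgy_eq0 f l : integrableT f -> f x @[x --> +oo] --> l -> l = 0.
Proof.
move=> fi fl; apply: contrapT => /eqP l0.
have nl : 0 < `|l| / 2 by rewrite divr_gt0// normr_gt0.
apply: (integrable_not_bounded_below f _ fi nl) => d d0.
have /cvgrPdist_le/(_ _ nl)[M [_ MP]] := fl.
exists (M + 1) => t /andP[Mt _].
have /MP : M < t by rewrite (lt_le_trans _ Mt)// ltrDl.
move=> /= h; have := ler_normB (l - f t) (- f t).
by rewrite opprK subrK normrN; lra.
Qed.

Lemma integrable_cvgNy_eq0 f l : integrableT f -> f x @[x --> -oo] --> l -> l = 0.
Proof.
move=> fi fl; apply: contrapT => /eqP l0.
have nl : 0 < `|l| / 2 by rewrite divr_gt0// normr_gt0.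
apply: (integrable_not_bounded_below f _ fi nl) => d d0.
have /cvgrPdist_le/(_ _ nl)[M [_ MP]] := fl.
exists (M - 1 - d) => t /andP[_ Mt].
have /MP : t < M by rewrite (le_lt_trans Mt)// subrK ltrBlDr ltrDl.
move=> /= h; have := ler_normB (l - f t) (- f t).
by rewrite opprK subrK normrN; lra.
Qed.

(** [G] differs from the primitive of [g] by a constant, so it has limits at
    both ends, and integrability forces both to be zero. *)
Lemma real_ac_integral_eq0 G g : real_ac G g -> integrableT G -> integrableT g ->
  \int[mu]_x g x = 0.
Proof.
move=> Gg iG ig; pose kappa := G 0 - primitive g 0.
have inc x y : x <= y -> G y - G x = primitive g y - primitive g x.
  move=> xy; rewrite (Gg _ _ xy).2 /primitive.
  have ig' : mu.-integrable `]-oo, y] (EFin \o g) by exact: integrableS ig.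
  rewrite (@Rintegral_itvB _ g -oo%O (BRight y) x ig')//.
  by rewrite Rintegral_itv_obnd_cbnd//; exact: integrableS ig.
have GE x : G x = kappa + primitive g x.
  rewrite /kappa; have [x0|x0] := leP x 0.
    by have := inc _ _ x0; lra.
  by have := inc _ _ (ltW x0); lra.
have Gfun : G = fun x => kappa + primitive g x by apply/funext.
have lNy : G x @[x --> -oo] --> kappa.
  rewrite Gfun -[X in _ --> X]addr0; apply: cvgD; first exact: cvg_cst.
  exact: primitive_cvgNy.
have ly : G x @[x --> +oo] --> kappa + \int[mu]_x g x.
  rewrite Gfun; apply: cvgD; first exact: cvg_cst.
  exact: primitive_cvgy.
have := integrable_cvgNy_eq0 _ _ iG lNy; have := integrable_cvgy_eq0 _ _ iG ly.
by lra.
Qed.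

Section MiuraForm.
Context (w : R -> R) (hw : schwartz w).

(** [<u, H v> = <(d + w) u, (d + w) v>]: the boundary term is
    [u (v' + w v)], which is integrable and hence vanishes at both ends. *)
Lemma miura_form u u1 v v1 v2 :
  u \in Lfun mu 2%:E -> u1 \in Lfun mu 2%:E ->
  v \in Lfun mu 2%:E -> v1 \in Lfun mu 2%:E -> v2 \in Lfun mu 2%:E ->
  real_ac u u1 -> real_ac v v1 -> real_ac v1 v2 ->
  integrableT (fun x => u x * (- v2 x - miura w x * v x)) /\
  \int[mu]_x (u x * (- v2 x - miura w x * v x)) =
  \int[mu]_x ((u1 x + w x * u x) * (v1 x + w x * v x)).
Proof.
move=> Lu Lu1 Lv Lv1 Lv2 uu1 vv1 v1v2.
have cw := schwartz_continuous w hw; have cdw := schwartz_derive_continuous w hw.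
have [B wB] := schwartz_bounded w hw; have [D dwD] := schwartz_derive_bounded w hw.
have iuv := Lfun2_integrableM _ _ Lu Lv.
have iwuv := integrable_bounded_mul _ _ _ cw wB iuv.
have iwwuv := integrable_bounded_mul _ _ _ cw wB iwuv.
have idwuv := integrable_bounded_mul _ _ _ cdw dwD iuv.
have iuv1 := Lfun2_integrableM _ _ Lu Lv1.
have iwuv1 := integrable_bounded_mul _ _ _ cw wB iuv1.
have iu1v := Lfun2_integrableM _ _ Lu1 Lv.
have iwu1v := integrable_bounded_mul _ _ _ cw wB iu1v.
have iu1v1 := Lfun2_integrableM _ _ Lu1 Lv1.
have iuv2 := Lfun2_integrableM _ _ Lu Lv2.
have acw : real_ac w (derive1 w).
  exact: real_ac_smooth (schwartz_is_derive w hw) cdw.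
have acG := real_acM _ _ _ _ uu1 (real_acD _ _ _ _ v1v2 (real_acM _ _ _ _ acw vv1)).
set g := (fun x => u1 x * _ + _) in acG.
have gE : g = fun x => u1 x * v1 x + w x * (u1 x * v x) + u x * v2 x +
    derive1 w x * (u x * v x) + w x * (u x * v1 x).
  by apply/funext => x; rewrite /g; ring.
have ig : integrableT g.
  rewrite gE; do 4 (apply: integrable_fun_add => //).
have iG : integrableT (fun x => u x * (v1 x + w x * v x)).
  rewrite (_ : (fun x => _) = (fun x => u x * v1 x + w x * (u x * v x))).
    exact: integrable_fun_add.
  by apply/funext => x; ring.
have iA : integrableT (fun x => (u1 x + w x * u x) * (v1 x + w x * v x)).
  rewrite (_ : (fun x => _) = (fun x => u1 x * v1 x + w x * (u1 x * v x) +
    w x * (u x * v1 x) + w x * (w x * (u x * v x)))).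
    by do 3 (apply: integrable_fun_add => //).
  by apply/funext => x; ring.
have E : (fun x => u x * (- v2 x - miura w x * v x)) =
    (fun x => (u1 x + w x * u x) * (v1 x + w x * v x) - g x).
  by apply/funext => x; rewrite /g /miura; ring.
split; first by rewrite E; exact: integrable_fun_sub.
by rewrite E RintegralB// (real_ac_integral_eq0 _ _ acG iG ig) subr0.
Qed.

Lemma ac_derivative_ReIm (f g : R -> R[i]) : ac_derivative f g ->
  real_ac (reP f) (reP g) /\ real_ac (imP f) (imP g).
Proof.
move=> fg; split=> x y xy; have [[ir ii] e] := fg _ _ xy; split=> //.
  by rewrite /reP -raddfB e.
by rewrite /imP -raddfB e.
Qed.

(** [H = (d + w)^* (d + w)]; the two cross terms of the sesquilinear form cancel
    because the bilinear form is symmetric. *)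
Lemma miura_schrodinger_ge0 : schrodinger_ge0 (miura w).
Proof.
move=> psi phi [psi1 [psi2 [[[La Lb] [La1 Lb1] [La2 Lb2]]]]].
move=> [/ac_derivative_ReIm[aa1 bb1] /ac_derivative_ReIm[a1a2 b1b2] phiE].
have rphi x : complex.Re (phi x) = - reP psi2 x - miura w x * reP psi x.
  by rewrite phiE /reP; case: (psi x) (psi2 x) => ? ? [? ?] /=; ring.
have iphi x : complex.Im (phi x) = - imP psi2 x - miura w x * imP psi x.
  by rewrite phiE /imP; case: (psi x) (psi2 x) => ? ? [? ?] /=; ring.
have [iaa Eaa] := miura_form _ _ _ _ _ La La1 La La1 La2 aa1 aa1 a1a2.
have [iab Eab] := miura_form _ _ _ _ _ La La1 Lb Lb1 Lb2 aa1 bb1 b1b2.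
have [iba Eba] := miura_form _ _ _ _ _ Lb Lb1 La La1 La2 bb1 aa1 a1a2.
have [ibb Ebb] := miura_form _ _ _ _ _ Lb Lb1 Lb Lb1 Lb2 bb1 bb1 b1b2.
rewrite /inner /cintegral lecE /=; apply/andP; split.
  rewrite (_ : imP _ = (fun x => reP psi x * (- imP psi2 x - miura w x * imP psi x) -
    imP psi x * (- reP psi2 x - miura w x * reP psi x))); last first.
    apply/funext => x; rewrite {1}/imP -rphi -iphi /reP /imP.
    by case: (psi x) (phi x) => ? ? [? ?] /=; ring.
  rewrite RintegralB// Eab Eba subr_eq0; apply/eqP.
  by apply: eq_Rintegral => x _; exact: mulrC.
rewrite (_ : reP _ = (fun x => reP psi x * (- reP psi2 x - miura w x * reP psi x) +
  imP psi x * (- imP psi2 x - miura w x * imP psi x))); last first.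
  apply/funext => x; rewrite {1}/reP -rphi -iphi /reP /imP.
  by case: (psi x) (phi x) => ? ? [? ?] /=; ring.
rewrite RintegralD// Eaa Ebb; apply: addr_ge0; apply: Rintegral_ge0 => x _.
  by rewrite -expr2 sqr_ge0.
by rewrite -expr2 sqr_ge0.
Qed.

End MiuraForm.
End Nonnegativity.

(** * Zero energy *)

Section ZeroEnergy.
Context {R : realType}.
Notation mu := (@lebesgue_measure R).
Context (w : R -> R) (hw : schwartz w).
Implicit Types (F : set_system R) (c x : R).

Let I := \int[mu]_x w x.
Let iw := schwartz_integrable w hw.

Lemma ground_state_cvg F {FF : Filter F} (l : R) :
  primitive w x @[x --> F] --> l -> ground_state w x @[x --> F] --> expR (- l).
Proof.
move=> Wl; apply: (@continuous_cvg _ _ _ F _ (fun x => - primitive w x) expR).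
  exact: continuous_expR.
exact: cvgN.
Qed.

Lemma zero_energy_real_jost F {FF : Filter F} c :
  c * ground_state w x @[x --> F] --> (1 : R) ->
  real_jost F (miura w) 0 (fun x => (c * ground_state w x)%:C).
Proof.
move=> c1; have gs := ground_state_solution w hw.
have e0 : (0 : R) ^+ 2 = 0 by rewrite expr0n.
split; rewrite ?e0.
- have := real_solution_lin c 0 gs gs; congr real_solution.
  by apply/funext => x; rewrite mul0r addr0.
- have := real_solution_lin 0 0 gs gs; congr real_solution.
  by apply/funext => x; rewrite !mul0r addr0.
- rewrite (_ : (fun x => _) = (fun x => c * ground_state w x - 1)).
    exact/subr_cvg0.
  by apply/funext => x; rewrite mul0r cos0.
- apply: cvg_near_cst; apply: nearW => x.
  by rewrite mul0r sin0 subr0.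
Qed.

Lemma jost_plus0 x :
  jost_plus (miura w) 0 x = (expR I * ground_state w x)%:C.
Proof.
rewrite -[X in jost_plus _ X](rmorph0 (real_complex R)).
rewrite (jost_plusE w 0 (fun x => (expR I * ground_state w x)%:C))//.
apply: zero_energy_real_jost; rewrite -[X in _ --> X]expR0 -(subrr I) expRD.
by apply: cvgMl_tmp; apply: ground_state_cvg; exact: primitive_cvgy.
Qed.

Lemma jost_minus0 x : jost_minus (miura w) 0 x = (1 * ground_state w x)%:C.
Proof.
rewrite -[X in jost_minus _ X](rmorph0 (real_complex R)).
rewrite (jost_minusE w 0 (fun x => (1 * ground_state w x)%:C))//.
rewrite oppr0; apply: zero_energy_real_jost.
rewrite -[X in _ --> X]mulr1; apply: cvgMl_tmp.
rewrite -[X in _ --> X]expR0 -[X in expR X]oppr0.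
by apply: ground_state_cvg; exact: primitive_cvgNy.
Qed.

(** Both Jost solutions are multiples of [ground_state]. *)
Lemma miura_exceptional : exceptional (miura w).
Proof.
have dg c x : cderive (fun x => (c * ground_state w x)%:C) x =
    (c * (- w x * ground_state w x))%:C.
  rewrite /cderive; congr (_ +i* _).
    by rewrite (is_derive_derive1 (fun x =>
      is_derive_fun_scale c (is_derive_ground_state w hw x))).
  by rewrite (_ : imP _ = cst 0)// derive1_cst.
have E1 : jost_plus (miura w) 0 = fun x => (expR I * ground_state w x)%:C.
  by apply/funext => x; exact: jost_plus0.
have E2 : jost_minus (miura w) 0 = fun x => (1 * ground_state w x)%:C.
  by apply/funext => x; exact: jost_minus0.
move=> x; rewrite /wronskian E1 E2 !dg -!rmorphM -rmorphB /=.
by apply/eqP; rewrite eq_complex /= eqxx andbT; apply/eqP; ring.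
Qed.

End ZeroEnergy.

(** * Scattering coefficients *)

Section Scattering.
Context {R : realType}.
Notation mu := (@lebesgue_measure R).
Context (w : R -> R) (hw : schwartz w).
Implicit Types (al be : R -> R) (k x : R).

Let I := \int[mu]_x w x.
Let q := miura w.
Let cw := schwartz_continuous w hw.
Let iw := schwartz_integrable w hw.

Section Transfer.
Context (k : R) (k0 : k != 0) (al1 be1 al2 be2 : R -> R) (A B C D : R).
Context (co1 : zs_connects w k al1 be1 1 0 A C)
        (co2 : zs_connects w k al2 be2 0 1 B D).

Let y1 := wave k al1 be1.
Let y2 := wave k al2 be2.

Let det : A * D - B * C = 1.
Proof. by have [_ ->] := zs_det w co1 co2; ring. Qed.

Let ys1 : real_solution q (k ^+ 2) y1.
Proof. by have [zs _ _ _ _] := co1; exact: wave_solution. Qed.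

Let ys2 : real_solution q (k ^+ 2) y2.
Proof. by have [zs _ _ _ _] := co2; exact: wave_solution. Qed.

Let lin_cvg0 (F : set_system R) {FF : Filter F} (f g : R -> R) (r s : R) :
  f x @[x --> F] --> (0 : R) -> g x @[x --> F] --> (0 : R) ->
  r * f x + s * g x @[x --> F] --> (0 : R).
Proof.
move=> f0 g0; have -> : (0 : R) = r * 0 + s * 0 by rewrite !mulr0 addr0.
exact: (cvgD (cvgMl_tmp f0) (cvgMl_tmp g0)).
Qed.

Let y1y : y1 x - (cos (k * x) * A + sin (k * x) * C) @[x --> +oo] --> (0 : R).
Proof. by have [_ _ _ h1 h2] := co1; exact: wave_asymptotic. Qed.

Let y2y : y2 x - (cos (k * x) * B + sin (k * x) * D) @[x --> +oo] --> (0 : R).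
Proof. by have [_ _ _ h1 h2] := co2; exact: wave_asymptotic. Qed.

Let y1Ny : y1 x - (cos (k * x) * 1 + sin (k * x) * 0) @[x --> -oo] --> (0 : R).
Proof. by have [_ h1 h2 _ _] := co1; exact: wave_asymptotic. Qed.

Let y2Ny : y2 x - (cos (k * x) * 0 + sin (k * x) * 1) @[x --> -oo] --> (0 : R).
Proof. by have [_ h1 h2 _ _] := co2; exact: wave_asymptotic. Qed.

Let P x := D * y1 x + (- C) * y2 x.
Let Q x := (- B) * y1 x + A * y2 x.

(** The combinations with limits [(1, 0)] and [(0, 1)] at [+oo]: their
    coefficients are the columns of the inverse transfer matrix. *)
Lemma transfer_jost_plus :
  jost_plus q k%:C = fun x => P x +i* Q x.
Proof.
apply: jost_plusE => //; split.
- exact: (real_solution_lin D (- C) ys1 ys2).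
- exact: (real_solution_lin (- B) A ys1 ys2).
- rewrite (_ : (fun x => _) = (fun x =>
    D * (y1 x - (cos (k * x) * A + sin (k * x) * C)) +
    (- C) * (y2 x - (cos (k * x) * B + sin (k * x) * D)))); first exact: lin_cvg0.
  apply/funext => x; rewrite -[cos (k * x) in LHS]mulr1 -det /reP /= /P.
  by ring.
- rewrite (_ : (fun x => _) = (fun x =>
    (- B) * (y1 x - (cos (k * x) * A + sin (k * x) * C)) +
    A * (y2 x - (cos (k * x) * B + sin (k * x) * D)))); first exact: lin_cvg0.
  apply/funext => x; rewrite -[sin (k * x) in LHS]mulr1 -det /imP /= /Q.
  by ring.
Qed.

Lemma transfer_jost_plus_opp :
  jost_plus q (- k%:C) = fun x => P x +i* - Q x.
Proof.
rewrite -rmorphN; apply: jost_plusE => //; split; rewrite ?sqrrN.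
- exact: (real_solution_lin D (- C) ys1 ys2).
- rewrite (_ : imP _ = (fun x => B * y1 x + (- A) * y2 x)).
    exact: (real_solution_lin B (- A) ys1 ys2).
  by apply/funext => x; rewrite /imP /= /Q; ring.
- rewrite (_ : (fun x => _) = (fun x =>
    D * (y1 x - (cos (k * x) * A + sin (k * x) * C)) +
    (- C) * (y2 x - (cos (k * x) * B + sin (k * x) * D)))); first exact: lin_cvg0.
  apply/funext => x; rewrite (mulNr k) cosN -[cos (k * x) in LHS]mulr1 -det /reP /= /P.
  by ring.
- rewrite (_ : (fun x => _) = (fun x =>
    B * (y1 x - (cos (k * x) * A + sin (k * x) * C)) +
    (- A) * (y2 x - (cos (k * x) * B + sin (k * x) * D)))); first exact: lin_cvg0.
  apply/funext => x; rewrite (mulNr k) sinN -[sin (k * x) in LHS]mulr1 -det /imP /= /Q.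
  by ring.
Qed.

Lemma transfer_jost_minus :
  jost_minus q k%:C = fun x => y1 x +i* - y2 x.
Proof.
apply: jost_minusE => //; split; rewrite ?sqrrN.
- exact: ys1.
- rewrite (_ : imP _ = (fun x => 0 * y1 x + (-1) * y2 x)).
    exact: (real_solution_lin 0 (-1) ys1 ys2).
  by apply/funext => x; rewrite /imP /=; ring.
- rewrite (_ : (fun x => _) = (fun x =>
    y1 x - (cos (k * x) * 1 + sin (k * x) * 0))); first exact: y1Ny.
  by apply/funext => x; rewrite (mulNr k) cosN /reP /=; ring.
- rewrite (_ : (fun x => _) = (fun x =>
    0 * (y1 x - (cos (k * x) * 1 + sin (k * x) * 0)) +
    (-1) * (y2 x - (cos (k * x) * 0 + sin (k * x) * 1)))); first exact: lin_cvg0.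
  by apply/funext => x; rewrite (mulNr k) sinN /imP /=; ring.
Qed.

(** At [+oo] the left Jost solution is
    [(A - iB) cos (kx) + (C - iD) sin (kx)]; rewriting it with exponentials
    gives the coefficients. *)
Lemma transfer_scattering :
  scat_a q k = ((A + D) / 2) +i* ((C - B) / 2) /\
  scat_b q k = ((A - D) / 2) +i* (- (B + C) / 2).
Proof.
rewrite /scat_a /scat_b.
suff -> : scattering_coeffs q k =
    (((A + D) / 2) +i* ((C - B) / 2), ((A - D) / 2) +i* (- (B + C) / 2)) by [].
rewrite /scattering_coeffs transfer_jost_plus transfer_jost_plus_opp.
rewrite transfer_jost_minus.
have coeffP (a b : R[i]) x : y1 x +i* - y2 x =
    a * (P x +i* - Q x) + b * (P x +i* Q x) <->
    y1 x = (complex.Re a + complex.Re b) * P x +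
       (complex.Im a - complex.Im b) * Q x /\
    - y2 x = (complex.Im a + complex.Im b) * P x +
       (complex.Re b - complex.Re a) * Q x.
  case: a b => a1 a2 [b1 b2] /=; split=> [/eqP|[e1 e2]]; last apply/eqP.
    by rewrite eq_complex /= => /andP[/eqP -> /eqP ->]; split; ring.
  by rewrite eq_complex /= e1 e2; apply/andP; split; apply/eqP; ring.
have y1E x : y1 x = A * P x + C * Q x.
  by rewrite -[LHS]mul1r -det /P /Q; ring.
have y2E x : - y2 x = (- B) * P x + (- D) * Q x.
  by rewrite -[LHS]mul1r -det /P /Q; ring.
apply: xget_unique.
  move=> x /=; apply/coeffP => /=; split; first by rewrite y1E; field.
  by rewrite y2E; field.
move=> [a b] /= ab.
have indep (r s : R) (f : R -> R) (r' s' : R) :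
    (forall x, f x = r * P x + s * Q x) -> (forall x, f x = r' * P x + s' * Q x) ->
    r = r' /\ s = s'.
  move=> e1 e2.
  have [h1 h2] : (r - r') * D - (s - s') * B = 0 /\
      - (r - r') * C + (s - s') * A = 0.
    apply: (wave_independent w k _ _ _ _ _ _ _ _ _ _ k0 co1 co2) => x.
    have := e1 x; rewrite e2 /P /Q -/y1 -/y2 => e; lra.
  split; apply/eqP; rewrite -subr_eq0; apply/eqP.
    rewrite -[LHS]mul1r -det.
    transitivity (A * ((r - r') * D - (s - s') * B) +
      B * (- (r - r') * C + (s - s') * A)); first by ring.
    by rewrite h1 h2; ring.
  rewrite -[LHS]mul1r -det.
  transitivity (C * ((r - r') * D - (s - s') * B) +
    D * (- (r - r') * C + (s - s') * A)); first by ring.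
  by rewrite h1 h2; ring.
have [ra sa] := indep _ _ _ _ _ y1E (fun x => ((coeffP a b x).1 (ab x)).1).
have [rb sb] := indep _ _ _ _ _ y2E (fun x => ((coeffP a b x).1 (ab x)).2).
case: a b ra sa rb sb {ab} => a1 a2 [b1 b2] /= ra sa rb sb.
by congr (_ +i* _, _ +i* _); lra.
Qed.

End Transfer.
End Scattering.

(** * The limit of small momentum *)

Section SmallMomentumLimit.
Context {R : realType}.
Notation mu := (@lebesgue_measure R).

Lemma cvg_linear_bound (f : R -> R) (l M : R) :
  (forall k, k != 0 -> `|f k - l| <= M * `|k|) -> f k @[k --> 0^'] --> l.
Proof.
move=> fM; apply/cvgrPdist_le => e e0.
have M0 : 0 < `|M| + 1 by rewrite ltr_wpDl.
near=> k; rewrite distrC; apply: (le_trans (fM k _)).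
  by near: k; exact: nbhs_dnbhs_neq.
apply: (@le_trans _ _ ((`|M| + 1) * `|k|)).
  by rewrite ler_wpM2r// (le_trans (ler_norm _))// lerDl.
rewrite mulrC -ler_pdivlMr//.
by near: k; apply: dnbhs0_le; rewrite divr_gt0.
Unshelve. all: by end_near. Qed.

Context (w : R -> R) (hw : schwartz w).
Let I := \int[mu]_x w x.

Lemma scattering_bounds : exists M, forall k, k != 0 -> exists A B C D : R,
  [/\ scat_a (miura w) k = ((A + D) / 2) +i* ((C - B) / 2),
      scat_b (miura w) k = ((A - D) / 2) +i* (- (B + C) / 2) &
  [/\ `|A - expR (- I)| <= M * `|k|, `|B| <= M * `|k|, `|C| <= M * `|k| &
      `|D - expR I| <= M * `|k|]].
Proof.
have [M MP] := zs_connection w (schwartz_continuous w hw)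
  (schwartz_integrable w hw) (schwartz_mul_integrable w hw).
exists M => k k0.
have [al1 [be1 [A [C [co1 hA hC]]]]] := MP k 1 0.
have [al2 [be2 [B [D [co2 hB hD]]]]] := MP k 0 1.
have [ea eb] := transfer_scattering w hw k k0 _ _ _ _ _ _ _ _ co1 co2.
exists A, B, C, D; split=> //.
move: hA hB hC hD; rewrite !mulr0 !mulr1 !subr0 normr1 normr0 addr0 add0r !mulr1.
by move=> *; split.
Qed.

Lemma scattering_limits :
  value_at_zero (scat_a (miura w)) (cosh I)%:C /\
  value_at_zero (scat_b (miura w)) (- sinh I)%:C.
Proof.
have [M MP] := scattering_bounds.
split; apply/cvg_complexP; split; apply: (cvg_linear_bound _ _ M) => k k0;
  have [A [B [C [D [ea eb [hA hB hC hD]]]]]] := MP k k0;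
  rewrite ?ea ?eb /= /cosh /sinh; move: hA hB hC hD; rewrite !ler_norml;
  by move=> /andP[? ?] /andP[? ?] /andP[? ?] /andP[? ?]; apply/andP; split; lra.
Qed.

Lemma cosh_neq0 (x : R) : cosh x != 0.
Proof. by rewrite gt_eqF// divr_gt0// addr_gt0// expR_gt0. Qed.

Lemma scattering_quotient_limits :
  value_at_zero (scat_T (miura w)) (sech I)%:C /\
  value_at_zero (scat_R (miura w)) (- tanh I)%:C.
Proof.
have [la lb] := scattering_limits.
have c0 : (cosh I)%:C != 0 :> R[i].
  rewrite -[0 : R[i]](rmorph0 (real_complex R)) (inj_eq (@complexI _)).
  exact: cosh_neq0.
have lV : value_at_zero (fun k => (scat_a (miura w) k)^-1) (cosh I)%:C^-1.
  exact: (cvgV c0 la).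
split.
  rewrite /value_at_zero /sech fmorphV.
  rewrite (_ : (fun k => _) = (fun k => (scat_a (miura w) k)^-1)) //.
  by apply/funext => k; rewrite /scat_T div1r.
rewrite /value_at_zero /tanh -mulNr rmorphM fmorphV.
exact: (cvgM lb lV).
Qed.

End SmallMomentumLimit.

Theorem theorem3p7 (R : realType) (w : R -> R) (hw : schwartz w) :
  let q : R -> R := fun x => (w^`())%classic x - w x ^+ 2 in
  let I : R := \int[lebesgue_measure]_x w x in
  [/\ schrodinger_ge0 q,
      exceptional q,
      (forall x : R, jost_plus q 0 x =
         (expR (\int[lebesgue_measure]_(t in `[x, +oo[) w t))%:C) &
      (forall x : R, jost_minus q 0 x =
         (expR (- \int[lebesgue_measure]_(t in `]-oo, x]) w t))%:C)] /\
  [/\ value_at_zero (scat_a q) (cosh I)%:C,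
      value_at_zero (scat_b q) (- sinh I)%:C,
      value_at_zero (scat_T q) (sech I)%:C &
      value_at_zero (scat_R q) (- tanh I)%:C].
Proof.
move=> q I; split; last first.
  have [la lb] := scattering_limits w hw.
  have [lT lR] := scattering_quotient_limits w hw.
  by split; [exact: la|exact: lb|exact: lT|exact: lR].
split.
- exact: miura_schrodinger_ge0.
- exact: miura_exceptional.
- move=> x; rewrite integral_itvy; last exact: schwartz_integrable.
  by rewrite expRD; exact: jost_plus0.
- by move=> x; rewrite -[expR _]mul1r; exact: jost_minus0.
Qed.
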